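(* There exists a 2-cyclic irreducible subnormal operator $S$ such that the equality $$\operatorname{clos}(\sigma(S)\setminus\sigma_e(S))=\operatorname{clos}(\operatorname{Int}(\sigma(S)))$$ does not hold.
   Context: All Hilbert spaces are separable and complex; operators are bounded and linear. An operator $S$ on $\mathcal H$ is subnormal if there are a Hilbert space $\mathcal K\supset\mathcal H$ and a normal operator $M$ on $\mathcal K$ with $M\mathcal H\subset\mathcal H$ and $S=M|_{\mathcal H}$. $S$ is irreducible if it has no nontrivial reducing subspaces. $\sigma(S)$ and $\sigma_e(S)$ denote the spectrum and essential spectrum; $\operatorname{Int}$ and $\operatorname{clos}$ denote interior and closure in $\mathbb C$. For $F_1,\dots,F_N\in\mathcal H$ let $P^2(S|F_1,\dots,F_N)=\operatorname{clos}\{\sum_{i=1}^N p_i(S)F_i: p_i \text{ polynomials}\}$. $S$ is $N$-cyclic if $\mathcal H=P^2(S|F_1,\dots,F_N)$ for some $F_1,\dots,F_N\in\mathcal H$ and $\mathcal H\neq P^2(S|G_1,\dots,G_{N-1})$ for all $G_1,\dots,G_{N-1}\in\mathcal H$. *)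

(* Defs.v *)
From mathcomp Require Import all_boot all_order all_algebra complex.
From mathcomp Require Import all_classical all_reals all_analysis.

Set Implicit Arguments.
Unset Strict Implicit.
Unset Printing Implicit Defensive.

Import Order.TTheory GRing.Theory Num.Theory.
Import numFieldNormedType.Exports.

Local Open Scope classical_set_scope.
Local Open Scope ring_scope.
Local Open Scope complex_scope.

(* Complex separable Hilbert spaces. [inner] is linear in its first argument
   and conjugate-linear in its second one. *)
Record hilbertType (R : realType) := HilbertType {
  hilbert_space :> completeNormedModType R[i];
  inner : {dot hilbert_space for @Num.conj R[i]};
  inner_norm : forall x : hilbert_space, inner x x = `|x| ^+ 2;
  hilbert_separable : exists2 D : set hilbert_space, countable D & dense D
}.

Section Operators.
Context {R : realType}.
Implicit Types H K : hilbertType R.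

Definition bounded_op H (T : {linear H -> H}) : Prop :=
  exists M : R[i], forall x : H, `|T x| <= M * `|x|.

Definition is_adjoint H (T T' : {linear H -> H}) : Prop :=
  forall x y : H, inner H (T x) y = inner H x (T' y).

Definition normal_op H (M : {linear H -> H}) : Prop :=
  bounded_op M /\
  exists M' : {linear H -> H},
    [/\ bounded_op M', is_adjoint M M' & forall x : H, M (M' x) = M' (M x)].

(* The inclusion of H in the larger space K is an isometric embedding J. *)
Definition subnormal H (S : {linear H -> H}) : Prop :=
  exists (K : hilbertType R) (J : {linear H -> K}) (M : {linear K -> K}),
    [/\ forall x y : H, inner K (J x) (J y) = inner H x y,
        normal_op M
      & forall x : H, M (J x) = J (S x)].

Definition closed_subspace H (L : set H) : Prop :=
  [/\ L 0,
      forall (a : R[i]) (x y : H), L x -> L y -> L (a *: x + y)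
    & closed L].

Definition orthogonal_complement H (L : set H) : set H :=
  [set y | forall x : H, L x -> inner H x y = 0].

Definition invariant H (T : {linear H -> H}) (L : set H) : Prop :=
  forall x : H, L x -> L (T x).

Definition reducing H (T : {linear H -> H}) (L : set H) : Prop :=
  [/\ closed_subspace L, invariant T L
    & invariant T (orthogonal_complement L)].

Definition irreducible H (T : {linear H -> H}) : Prop :=
  forall L : set H, reducing T L -> L = [set 0] \/ L = setT.

Definition invertible_op H (T : H -> H) : Prop :=
  exists T' : {linear H -> H},
    [/\ bounded_op T', cancel T T' & cancel T' T].

Definition finite_dimensional H (L : set H) : Prop :=
  exists (n : nat) (v : 'I_n -> H), forall x : H, L x ->
    exists c : 'I_n -> R[i], x = \sum_(i < n) c i *: v i.

Definition finite_codimensional H (L : set H) : Prop :=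
  exists (n : nat) (v : 'I_n -> H), forall x : H,
    exists2 y : H, L y &
      exists c : 'I_n -> R[i], x = y + \sum_(i < n) c i *: v i.

Definition fredholm H (T : H -> H) : Prop :=
  [/\ finite_dimensional [set x | T x = 0], closed (range T)
    & finite_codimensional (range T)].

(* [R[i]^o] is [R[i]] with its norm topology. *)
Definition spectrum H (T : {linear H -> H}) : set R[i]^o :=
  [set l | ~ invertible_op (fun x : H => T x - l *: x)].

Definition essential_spectrum H (T : {linear H -> H}) : set R[i]^o :=
  [set l | ~ fredholm (fun x : H => T x - l *: x)].

Definition poly_op H (T : {linear H -> H}) (p : {poly R[i]}) (x : H) : H :=
  \sum_(k < size p) p`_k *: iter k T x.

Definition P2 H (T : {linear H -> H}) (n : nat) (F : 'I_n -> H) : set H :=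
  closure [set y | exists p : 'I_n -> {poly R[i]},
                     y = \sum_(i < n) poly_op T (p i) (F i)].

(* Meaningful for 0 < n; since 0.-1 = 0, no operator is 0-cyclic. *)
Definition cyclic_op (n : nat) H (T : {linear H -> H}) : Prop :=
  (exists F : 'I_n -> H, P2 T F = setT) /\
  (forall G : 'I_n.-1 -> H, P2 T G <> setT).

End Operators.

(* Main.v *)
(* Let lam enumerate injectively a dense subset of the disc |z - 1/2| < 1/8. On
   K = L^2(T) + l^2 + L^2(T) consider the normal operator M acting as z on the
   first summand, as diag(lam) on the second one and as z/4 on the third one. The
   triples (f, u, g) with g in H^2 such that f - sum_k 2^-k u_k / (z - lam k)
   - g(0) / z lies in H^2 form a closed M-invariant subspace H; S is the
   restriction of M to H.

   Modulo the functions f in H^2, S is diag(lam) + (1/4) shift, coupled to the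
   shift by a finite-rank operator. Unit vectors of l^2 at nodes converging to z
   make S - z fail to have closed range for all |z - 1/2| < 1/8, so that this
   disc lies in the spectrum but misses its nonessential part. Two independent
   functionals kill the range of S, hence S is not cyclic; (1, 0, 0) and a vector
   with last components v and 1, with v decreasing fast enough, generate H. If L
   reduces S and x, y belong to L and to its complement, applying S to both and using |z| = 1
   and |z| = 1/4 on the two circles separates the contributions of the three
   summands to <x, y> = 0: u_k(x) u_k(y)^* = 0 for all k and g(x), g(y) are
   orthogonal. Decomposing (1, 0, 0) then shows that it lies in L or in its
   complement, and the coupling forces that space to be all of H. *)
Require Import Defs.
From HB Require Import structures.
From mathcomp Require Import all_boot all_order all_algebra complex.
From mathcomp Require Import all_classical all_reals all_analysis.
From mathcomp Require Import ring lra.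

Set Implicit Arguments.
Unset Strict Implicit.
Unset Printing Implicit Defensive.

Import Order.TTheory GRing.Theory Num.Theory.
Import numFieldNormedType.Exports.

Local Open Scope classical_set_scope.
Local Open Scope complex_scope.
Local Open Scope ring_scope.

(** A direct sum of the three pieces would have two functionals killing its range but many reducing
    subspaces. The coupling through the principal part of f removes the reducing subspaces and keeps
    the functionals: 0 lies inside both circles, and each of the two Hardy components contributes
    one functional there, provided that the pole g(0)/z is compensated in the value of f at 0.

    The constants serve one purpose: 3/8 <= |lam k| <= 5/8 lies strictly between the radii 1/4 and
    1. The bound 5/8 < 1 makes 1/(z - lam k) expand in negative powers of z with geometric decay.
    The bound away from 0 allows evaluation at 0. The gap on both sides makes (1 - |lam k|^2)(|lam
    k|^2 - 1/16) nonzero, which isolates the l^2 part. The inequality 1/4 < 3/8 lets a polynomial be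
    prescribed at nodes while being negligible on the small circle. The weights 2^-k make the
    coupling bounded and also make its effect on the k-th coordinate vector vanish as k grows.

    On H the components f_+ (the nonnegative powers), u and g are free and the principal part of f
    is determined by u and g(0); most estimates therefore concern only u and g. *)

Notation nm := Normc.normc.

(** * Real-valued modulus of complex numbers *)

Section Modulus.
Context {R : realType}.
Implicit Types z w : R[i].

Lemma normE z : `|z| = (nm z)%:C. Proof. by case: z. Qed.

Lemma nm_ge0 z : 0 <= nm z. Proof. by case: z => a b; exact: sqrtr_ge0. Qed.

Lemma nmD z w : nm (z + w) <= nm z + nm w. Proof. exact: le_normcD. Qed.

Lemma nmN z : nm (- z) = nm z. Proof. exact: normcN. Qed.

Lemma nmB z w : nm (z - w) <= nm z + nm w.
Proof. by rewrite -(nmN w); exact: nmD. Qed.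

Lemma nmBC z w : nm (z - w) = nm (w - z).
Proof. by rewrite -nmN opprB. Qed.

Lemma nmJ z : nm z^* = nm z.
Proof. by case: z => a b /=; rewrite sqrrN. Qed.

Lemma nm_real (r : R) : nm r%:C = `|r|.
Proof. by rewrite /= expr0n addr0 sqrtr_sqr. Qed.

Lemma nmX z n : nm (z ^+ n) = nm z ^+ n.
Proof.
elim: n => [|n IH]; first by rewrite !expr0 Normc.normc1.
by rewrite !exprS Normc.normcM IH.
Qed.

Lemma nm_sum I (r : seq I) (P : pred I) (F : I -> R[i]) :
  nm (\sum_(i <- r | P i) F i) <= \sum_(i <- r | P i) nm (F i).
Proof.
elim/big_rec2: _ => [|i a b _ H]; first by rewrite Normc.normc0.
by rewrite (le_trans (nmD _ _))// lerD2l.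
Qed.

Lemma mulCJ z : z * z^* = (nm z ^+ 2)%:C.
Proof.
case: z => a b /=; rewrite sqr_sqrtr ?addr_ge0 ?sqr_ge0//.
by simpc; rewrite -!expr2 mulrC addNr.
Qed.

Lemma Re_le_nm z : `|complex.Re z| <= nm z.
Proof.
by case: z => a b /=; rewrite -sqrtr_sqr ler_wsqrtr// lerDl sqr_ge0.
Qed.

Lemma Im_le_nm z : `|complex.Im z| <= nm z.
Proof.
by case: z => a b /=; rewrite -sqrtr_sqr ler_wsqrtr// lerDr sqr_ge0.
Qed.

Lemma nm_le_ReIm z : nm z <= `|complex.Re z| + `|complex.Im z|.
Proof.
case: z => a b /=; rewrite -[leRHS]ger0_norm ?addr_ge0// -sqrtr_sqr ler_wsqrtr//.
rewrite sqrrD !real_normK ?num_real// -addrA lerD2l lerDr.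
by rewrite mulrn_wge0// mulr_ge0.
Qed.

Lemma small_eq0 z : (forall e : R, 0 < e -> nm z <= e) -> z = 0.
Proof.
move=> H; apply/Normc.eq0_normc/eqP; rewrite eq_le nm_ge0 andbT.
by apply/ler_addgt0Pl => e e0; rewrite addr0 H.
Qed.

End Modulus.

Lemma sum_ord_widen0 (V : zmodType) (x : nat -> V) N n : (N <= n)%N ->
  (forall i, (N <= i)%N -> x i = 0) -> \sum_(i < n) x i = \sum_(i < N) x i.
Proof.
move=> Nn H; rewrite -!(big_mkord xpredT x) (@big_cat_nat _ _ _ N)//=.
rewrite [X in _ + X](_ : _ = 0) ?addr0//.
by rewrite big_nat_cond big1// => i /andP[/andP[/H]].
Qed.

Lemma sum_ord_widen (K : numDomainType) (x : nat -> K) n N : (n <= N)%N ->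
  (forall i, 0 <= x i) -> \sum_(i < n) x i <= \sum_(i < N) x i.
Proof.
move=> nN H; rewrite -!(big_mkord xpredT x) [leRHS](@big_cat_nat _ _ _ n)//=.
by rewrite lerDl sumr_ge0.
Qed.

(** * Complex series and square-summable sequences *)

Section Sums.
Context {R : realType}.
Implicit Types (x y : nat -> R[i]) (l : R[i]).

Definition sums_to x l := forall e : R, 0 < e ->
  exists N, forall n, (N <= n)%N -> nm (\sum_(i < n) x i - l) < e.

Definition abssum x := exists M : R, forall n, \sum_(i < n) nm (x i) <= M.

(** Total by convention: a divergent series gets the default value 0, hence the summability
    hypotheses in the algebraic laws. *)
Definition csum x : R[i] := xget 0 [set l | sums_to x l].

Lemma sums_to_uniq x l l' : sums_to x l -> sums_to x l' -> l = l'.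
Proof.
move=> H H'; apply/eqP; rewrite -subr_eq0; apply/eqP/small_eq0 => e e0.
have e2 : 0 < e / 2 by rewrite divr_gt0.
have [N HN] := H _ e2; have [N' HN'] := H' _ e2.
have := HN (maxn N N') (leq_maxl _ _); have := HN' (maxn N N') (leq_maxr _ _).
set s := \sum_(_ < _) _ => h1 h2.
have -> : l - l' = (s - l') - (s - l) by ring.
have := nmB (s - l') (s - l); lra.
Qed.

Lemma sums_to_csum x l : sums_to x l -> csum x = l.
Proof.
move=> H; rewrite /csum; case: xgetP => [y _ /= Hy|/(_ l)//].
exact: sums_to_uniq Hy H.
Qed.

Lemma sums_toD x y l l' : sums_to x l -> sums_to y l' ->
  sums_to (fun i => x i + y i) (l + l').
Proof.
move=> H H' e e0; have e2 : 0 < e / 2 by rewrite divr_gt0.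
have [N HN] := H _ e2; have [N' HN'] := H' _ e2.
exists (maxn N N') => n; rewrite geq_max => /andP[/HN h1 /HN' h2].
rewrite big_split /= opprD addrACA.
have := nmD (\sum_(i < n) x i - l) (\sum_(i < n) y i - l'); lra.
Qed.

Lemma sums_toZ x l (c : R[i]) : sums_to x l -> sums_to (fun i => c * x i) (c * l).
Proof.
move=> H e e0; have c0 : 0 < nm c + 1 by have := nm_ge0 c; lra.
have [N HN] := H (e / (nm c + 1)) (divr_gt0 e0 c0).
exists N => n /HN h; rewrite -mulr_sumr -mulrBr Normc.normcM.
move: h; rewrite ltr_pdivlMr// => h.
apply: le_lt_trans h; rewrite mulrC ler_wpM2l ?nm_ge0//; lra.
Qed.

Lemma sums_toJ x l : sums_to x l -> sums_to (fun i => (x i)^*) l^*.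
Proof.
move=> H e /H[N HN]; exists N => n /HN.
by rewrite -nmJ rmorphB rmorph_sum.
Qed.

Lemma sums_toS x l : sums_to (fun i => x i.+1) l -> sums_to x (x 0%N + l).
Proof.
move=> H e /H[N HN]; exists N.+1 => -[//|n] /HN.
rewrite big_ord_recl/=; congr (nm _ < _); under eq_bigr do rewrite /bump /=.
by rewrite opprD addrACA subrr add0r.
Qed.

Lemma sums_to_fin x N : (forall i, (N <= i)%N -> x i = 0) ->
  sums_to x (\sum_(i < N) x i).
Proof.
move=> H e e0; exists N => n Nn.
by rewrite (sum_ord_widen0 Nn H) subrr Normc.normc0.
Qed.

Lemma sums_to_norm x l (M : R) : sums_to x l ->
  (forall n, nm (\sum_(i < n) x i) <= M) -> nm l <= M.
Proof.
move=> H HM; apply/ler_addgt0Pr => e /H[N /(_ N (leqnn _)) h].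
have := HM N; have := nmB (\sum_(i < N) x i) (\sum_(i < N) x i - l).
rewrite opprB addrCA subrr addr0 => h1 h2; lra.
Qed.

Lemma real_series_conv (u : nat -> R) (M : R) :
  (forall n, \sum_(i < n) `|u i| <= M) ->
  exists l : R, forall e, 0 < e ->
    exists N, forall n, (N <= n)%N -> `|\sum_(i < n) u i - l| < e.
Proof.
move=> HM.
have cu : cvgn (series u).
  apply: normed_cvg; apply: nondecreasing_is_cvgn.
    apply/nondecreasing_seqP => n; rewrite /normed_series_of /series /= big_nat_recr//=.
    by rewrite lerDl.
  exists M => _ [n _ <-] /=; rewrite /series /= big_mkord; exact: HM.
exists (limn (series u)) => e e0.
have /cvgrPdist_lt /(_ e e0) [N _ HN] := cu.
exists N => n /HN /=; rewrite distrC /series /= big_mkord//.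
Qed.

Lemma abssum_sums x : abssum x -> sums_to x (csum x).
Proof.
case=> M HM.
have [|a Ha] := @real_series_conv (fun i => complex.Re (x i)) M.
  move=> n; apply: le_trans (HM n); apply: ler_sum => i _; exact: Re_le_nm.
have [|b Hb] := @real_series_conv (fun i => complex.Im (x i)) M.
  move=> n; apply: le_trans (HM n); apply: ler_sum => i _; exact: Im_le_nm.
suff H : sums_to x (a +i* b) by rewrite (sums_to_csum H).
move=> e e0; have e2 : 0 < e / 2 by rewrite divr_gt0.
have [N HN] := Ha _ e2; have [N' HN'] := Hb _ e2.
exists (maxn N N') => n; rewrite geq_max => /andP[/HN h1 /HN' h2].
apply: le_lt_trans (nm_le_ReIm _) _.
rewrite !raddfB/= !raddf_sum/=; move: h1 h2 => /=; lra.
Qed.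

Lemma abssum_le x y : abssum y -> (forall i, nm (x i) <= nm (y i)) -> abssum x.
Proof.
move=> [M HM] H; exists M => n; apply: le_trans (HM n).
by apply: ler_sum.
Qed.

Lemma abssumD x y : abssum x -> abssum y -> abssum (fun i => x i + y i).
Proof.
move=> [M HM] [M' HM']; exists (M + M') => n.
apply: le_trans (lerD (HM n) (HM' n)); rewrite -big_split /=.
by apply: ler_sum => i _; exact: nmD.
Qed.

Lemma abssumZ x c : abssum x -> abssum (fun i => c * x i).
Proof.
move=> [M HM]; exists (nm c * M) => n.
under eq_bigr do rewrite Normc.normcM; rewrite -mulr_sumr.
by rewrite ler_wpM2l// nm_ge0.
Qed.

Lemma abssumS x : abssum x -> abssum (fun i => x i.+1).
Proof.
move=> [M HM]; exists M => n; apply: le_trans (HM n.+1).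
by rewrite [leRHS]big_ord_recl lerDr nm_ge0.
Qed.

Lemma csumD x y : abssum x -> abssum y ->
  csum (fun i => x i + y i) = csum x + csum y.
Proof.
by move=> /abssum_sums hx /abssum_sums hy; apply/sums_to_csum/sums_toD.
Qed.

Lemma csumZ x c : abssum x -> csum (fun i => c * x i) = c * csum x.
Proof. by move=> /abssum_sums hx; apply/sums_to_csum/sums_toZ. Qed.

Lemma csumJ x : abssum x -> csum (fun i => (x i)^*) = (csum x)^*.
Proof. by move=> /abssum_sums hx; apply/sums_to_csum/sums_toJ. Qed.

Lemma csumS x : abssum x -> csum x = x 0%N + csum (fun i => x i.+1).
Proof.
by move=> /abssumS/abssum_sums hx; apply/sums_to_csum/sums_toS.
Qed.

Lemma csum_fin x N : (forall i, (N <= i)%N -> x i = 0) ->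
  csum x = \sum_(i < N) x i.
Proof. by move=> /sums_to_fin/sums_to_csum. Qed.

Lemma abssum_fin x N : (forall i, (N <= i)%N -> x i = 0) -> abssum x.
Proof.
move=> H; exists (\sum_(i < N) nm (x i)) => n.
have [nN|/ltnW Nn] := leqP n N.
  by apply: (@sum_ord_widen _ (fun i => nm (x i))) => // i; exact: nm_ge0.
by rewrite (sum_ord_widen0 (x := fun i => nm (x i)) Nn)// => i /H ->; rewrite Normc.normc0.
Qed.

Lemma csum0 : csum (fun=> 0) = 0.
Proof. by rewrite (@csum_fin _ 0) ?big_ord0. Qed.

Lemma csum_single x k : (forall i, i != k -> x i = 0) -> csum x = x k.
Proof.
move=> H; rewrite (@csum_fin _ k.+1) => [|i ki]; last first.
  by apply: H; rewrite gtn_eqF.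
rewrite big_ord_recr/= big1 ?add0r// => i _; apply: H.
by rewrite ltn_eqF.
Qed.

Lemma nm_csum_le x (M : R) : (forall n, \sum_(i < n) nm (x i) <= M) ->
  nm (csum x) <= M.
Proof.
move=> H; apply: (sums_to_norm (abssum_sums (ex_intro _ M H))) => n.
exact: le_trans (nm_sum _ _ _) (H n).
Qed.

End Sums.

Section SquareSummable.
Context {R : realType}.
Implicit Types (x y z : nat -> R[i]).

Definition sqs x := exists M : R, forall n, \sum_(i < n) nm (x i) ^+ 2 <= M.

Definition sdot x y : R[i] := csum (fun i => x i * (y i)^*).

(** The real part loses nothing, since [sdot x x] is real for square-summable x. *)
Definition sqn x : R := complex.Re (sdot x x).

Lemma nmD2 (z w : R[i]) : nm (z + w) ^+ 2 <= 2 * nm z ^+ 2 + 2 * nm w ^+ 2.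
Proof.
apply: (@le_trans _ _ ((nm z + nm w) ^+ 2)).
  by rewrite ler_sqr ?nnegrE ?addr_ge0 ?nm_ge0// nmD.
by have := sqr_ge0 (nm z - nm w); rewrite sqrrB sqrrD; lra.
Qed.

Lemma sqs0 : sqs (fun=> 0).
Proof. by exists 0 => n; rewrite big1// => i _; rewrite Normc.normc0 expr0n. Qed.

Lemma sqs_le x y (c : R) : sqs y -> (forall i, nm (x i) <= c * nm (y i)) -> sqs x.
Proof.
move=> [M HM] H; exists (c ^+ 2 * M) => n.
apply: le_trans (ler_wpM2l (sqr_ge0 c) (HM n)); rewrite mulr_sumr.
apply: ler_sum => i _; rewrite -exprMn.
have h := le_trans (nm_ge0 _) (H i).
by rewrite ler_sqr ?nnegrE ?nm_ge0.
Qed.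

Lemma sqsZ x c : sqs x -> sqs (fun i => c * x i).
Proof. by move=> h; apply: (sqs_le (c := nm c) h) => i; rewrite Normc.normcM. Qed.

Lemma sqsD x y : sqs x -> sqs y -> sqs (fun i => x i + y i).
Proof.
move=> [M HM] [M' HM']; exists (2 * M + 2 * M') => n.
apply: le_trans (_ : \sum_(i < n) (2 * nm (x i) ^+ 2 + 2 * nm (y i) ^+ 2) <= _).
  by apply: ler_sum => i _; exact: nmD2.
by rewrite big_split/= -!mulr_sumr lerD// ler_wpM2l// ?HM ?HM'.
Qed.

Lemma sqs_mul x (t : nat -> R[i]) (c : R) : (forall i, nm (t i) <= c) ->
  sqs x -> sqs (fun i => t i * x i).
Proof.
move=> H h; apply: (sqs_le (c := c) h) => i.
by rewrite Normc.normcM ler_wpM2r// nm_ge0.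
Qed.

Lemma sqsS x : sqs x -> sqs (fun i => x i.+1).
Proof.
move=> [M HM]; exists M => n; apply: le_trans (HM n.+1).
by rewrite [leRHS]big_ord_recl/= lerDr sqr_ge0.
Qed.

Lemma sqs_cons x a : sqs x -> sqs (fun i => if i is j.+1 then x j else a).
Proof.
move=> [M HM]; exists (nm a ^+ 2 + M) => -[|n].
  by rewrite big_ord0 addr_ge0 ?sqr_ge0//; have := HM 0%N; rewrite big_ord0.
by rewrite big_ord_recl/= lerD2l; exact: HM.
Qed.

Lemma sqs_fin x N : (forall i, (N <= i)%N -> x i = 0) -> sqs x.
Proof.
move=> H; exists (\sum_(i < N) nm (x i) ^+ 2) => n.
have [nN|/ltnW Nn] := leqP n N.
  apply: (@sum_ord_widen _ (fun i => nm (x i) ^+ 2)) => // i; exact: sqr_ge0.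
rewrite (sum_ord_widen0 (x := fun i => nm (x i) ^+ 2) Nn)// => i /H ->.
by rewrite Normc.normc0 expr0n.
Qed.

Lemma abssum_dot x y : sqs x -> sqs y -> abssum (fun i => x i * (y i)^*).
Proof.
move=> [M HM] [M' HM']; exists ((M + M') / 2) => n.
rewrite ler_pdivlMr// mulr_suml.
apply: le_trans (lerD (HM n) (HM' n)); rewrite -big_split/=.
apply: ler_sum => i _; rewrite Normc.normcM nmJ.
by have := sqr_ge0 (nm (x i) - nm (y i)); rewrite sqrrB; lra.
Qed.

Lemma sdotDl x y z : sqs x -> sqs y -> sqs z ->
  sdot (fun i => x i + y i) z = sdot x z + sdot y z.
Proof.
move=> hx hy hz; rewrite /sdot -csumD; try exact: abssum_dot.
by congr csum; apply/funext => i; rewrite mulrDl.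
Qed.

Lemma sdotZl x z c : sqs x -> sqs z -> sdot (fun i => c * x i) z = c * sdot x z.
Proof.
move=> hx hz; rewrite /sdot -csumZ; last exact: abssum_dot.
by congr csum; apply/funext => i; rewrite mulrA.
Qed.

Lemma sdotC x y : sqs x -> sqs y -> sdot x y = (sdot y x)^*.
Proof.
move=> hx hy; rewrite /sdot -csumJ; last exact: abssum_dot.
by congr csum; apply/funext => i; rewrite rmorphM/= conjCK mulrC.
Qed.

Lemma sdotS x y : sqs x -> sqs y ->
  sdot x y = x 0%N * (y 0%N)^* + sdot (fun i => x i.+1) (fun i => y i.+1).
Proof. by move=> hx hy; rewrite /sdot csumS//; exact: abssum_dot. Qed.

Lemma sdot0l y : sdot (fun=> 0) y = 0.
Proof.
rewrite /sdot -[RHS](@csum0 R); congr csum; apply/funext => i.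
by rewrite mul0r.
Qed.

Lemma sdot_single x y k : (forall i, i != k -> x i = 0) ->
  sdot x y = x k * (y k)^*.
Proof. by move=> H; apply: csum_single => i /H ->; rewrite mul0r. Qed.

Lemma sqn_psum x n : \sum_(i < n) x i * (x i)^* = (\sum_(i < n) nm (x i) ^+ 2)%:C.
Proof. by rewrite rmorph_sum; apply: eq_bigr => i _; rewrite mulCJ. Qed.

(** The partial sums are real and increasing, so their complex limit is real and is their supremum.
    This turns the later norm estimates into estimates of finite sums. *)
Lemma sqn_spec x : sqs x ->
  [/\ sdot x x = (sqn x)%:C,
      forall n, \sum_(i < n) nm (x i) ^+ 2 <= sqn x
    & forall M, (forall n, \sum_(i < n) nm (x i) ^+ 2 <= M) -> sqn x <= M].
Proof.
move=> hx; have hs := abssum_sums (abssum_dot hx hx).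
have [a [b ab]] : exists a b, sdot x x = a +i* b.
  by case: (sdot x x) => a b; exists a, b.
rewrite -/(sdot x x) in hs.
have key e : 0 < e -> exists N, forall n, (N <= n)%N ->
    `|\sum_(i < n) nm (x i) ^+ 2 - a| < e /\ `|b| < e.
  move=> /hs [N HN]; exists N => n /HN; rewrite sqn_psum ab => h.
  set r := \sum_(i < n) _ in h *.
  have E : r%:C - (a +i* b) = (r - a) +i* (- b) by simpc.
  rewrite E in h.
  have := Re_le_nm ((r - a) +i* (- b)); have := Im_le_nm ((r - a) +i* (- b)).
  by rewrite /= normrN => h1 h2; split; [exact: le_lt_trans h2 h | exact: le_lt_trans h1 h].
have b0 : b = 0.
  apply/eqP; rewrite -normr_le0; apply/ler_addgt0Pl => e /key[N].
  by move=> /(_ N (leqnn _)) [_ /ltW]; rewrite addr0.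
rewrite /sqn ab /= b0; split => //.
  move=> n; apply/ler_addgt0Pr => e /key[N].
  move=> /(_ (maxn n N) (leq_maxr _ _))[+ _].
  have : \sum_(i < n) nm (x i) ^+ 2 <= \sum_(i < maxn n N) nm (x i) ^+ 2.
    apply: (@sum_ord_widen _ (fun i => nm (x i) ^+ 2)); first exact: leq_maxl.
    by move=> i; exact: sqr_ge0.
  by rewrite ltr_norml => h /andP[h1 h2]; lra.
move=> M H; apply/ler_addgt0Pr => e /key[N].
move=> /(_ N (leqnn _)) [+ _].
by have := H N; rewrite ltr_norml => h /andP[h1 h2]; lra.
Qed.

Lemma sdot_sqn x : sqs x -> sdot x x = (sqn x)%:C.
Proof. by case/sqn_spec. Qed.

Lemma sqn_ub x n : sqs x -> \sum_(i < n) nm (x i) ^+ 2 <= sqn x.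
Proof. by case/sqn_spec. Qed.

Lemma sqn_le x (M : R) : (forall n, \sum_(i < n) nm (x i) ^+ 2 <= M) -> sqn x <= M.
Proof.
move=> H; have hx : sqs x by exists M.
by case: (sqn_spec hx) => _ _; exact.
Qed.

Lemma sqn_ge0 x : sqs x -> 0 <= sqn x.
Proof. by move=> /(sqn_ub 0); rewrite big_ord0. Qed.

Lemma nm_coord_sqn x i : sqs x -> nm (x i) ^+ 2 <= sqn x.
Proof.
move=> /(sqn_ub i.+1); apply: le_trans; rewrite big_ord_recr/= lerDr.
by apply: sumr_ge0 => j _; exact: sqr_ge0.
Qed.

Lemma sqn_eq0 x : sqs x -> sqn x = 0 -> x = fun=> 0.
Proof.
move=> hx h; apply/funext => i; apply/Normc.eq0_normc/eqP.
by rewrite -sqrf_eq0 eq_le sqr_ge0 andbT -h nm_coord_sqn.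
Qed.

Lemma sqnN x y : sqn (fun i => x i - y i) = sqn (fun i => y i - x i).
Proof.
rewrite /sqn /sdot; congr (complex.Re (csum _)); apply/funext => i.
by rewrite -opprB rmorphN mulrNN.
Qed.

Lemma sqn_tail x (e : R) : sqs x -> 0 < e ->
  exists N, forall n, (N <= n)%N -> sqn (fun i => if (i < n)%N then 0 else x i) <= e.
Proof.
move=> hx e0.
have [N] := abssum_sums (abssum_dot hx hx) e0; rewrite -/(sdot x x) => HN.
exists N => n Nn.
apply: sqn_le => m; have [mn|nm'] := leqP m n.
  rewrite big1 ?ltW// => i _.
  by rewrite (leq_trans (ltn_ord i) mn) Normc.normc0 expr0n.
have := HN n Nn; rewrite sqn_psum sdot_sqn// -rmorphB/= expr0n addr0 sqrtr_sqr.
have := sqn_ub m hx.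
rewrite -(big_mkord xpredT (fun i => nm (x i) ^+ 2)).
rewrite -(big_mkord xpredT (fun i => nm (if (i < n)%N then 0 else x i) ^+ 2)).
rewrite !(@big_cat_nat _ _ _ n 0 m)//=; try exact: ltnW.
rewrite big_mkord.
rewrite [X in _ -> _ -> X + _ <= _]big_nat_cond [X in _ -> _ -> X + _ <= _]big1.
  rewrite add0r.
  rewrite [X in _ -> _ -> X <= _](_ : _ = \sum_(n <= i < m) nm (x i) ^+ 2).
    by rewrite ltr_norml => h /andP[h1 h2]; lra.
  by apply: eq_big_nat => i /andP[ni _]; rewrite ltnNge ni.
by move=> i /andP[/andP[_ ->] _]; rewrite Normc.normc0 expr0n.
Qed.

End SquareSummable.

(** * Cauchy-Schwarz and triangle inequalities for dot products *)

Section DotTheory.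
Context {C : numClosedFieldType} {U : lmodType C}.
Context (form : {dot U for @Num.conj C}).

(** Pythagoras for the splitting of u into its component a v along v and the orthogonal remainder
    w. *)
Lemma dot_CauchySchwarz u v : `|form u v| ^+ 2 <= form u u * form v v.
Proof.
have [->|v0] := eqVneq v 0.
  have /eqP -> : form 0 0 == 0 by rewrite dnorm_eq0.
  by rewrite linear0r normr0 expr0n mulr0.
set a := form u v / form v v; set w := u - a *: v.
have vv : form v v != 0 by rewrite dnorm_eq0.
have wv : form w v = 0 by rewrite /w linearBl /= linearZl_LR divfK ?subrr.
have uE : form u u = form w w + `|a| ^+ 2 * form v v.
  have -> : u = w + a *: v by rewrite /w subrK.
  rewrite hnormDd; first by congr (_ + _); exact: (dnormZ form).
  by rewrite linearZr_LR/= wv mulr0.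
have fE : form u v = a * form v v by rewrite divfK.
rewrite fE uE normrM exprMn (ger0_norm (dnorm_ge0 form _)) mulrDl -[X in _ + X]mulrA -expr2.
by rewrite lerDr mulr_ge0 ?(dnorm_ge0 form).
Qed.

Lemma dot_triangle u v :
  sqrtC (form (u + v) (u + v)) <= sqrtC (form u u) + sqrtC (form v v).
Proof.
rewrite -[leRHS]ger0_norm ?addr_ge0 ?sqrtC_ge0 ?(dnorm_ge0 form)//.
rewrite -[leLHS]ger0_norm ?sqrtC_ge0 ?(dnorm_ge0 form)// -ler_sqr ?nnegrE//.
rewrite !real_normK ?ger0_real ?addr_ge0 ?sqrtC_ge0 ?(dnorm_ge0 form)//.
rewrite sqrrD !sqrtCK (dnormD form) [leRHS]addrAC lerD2l.
have H1 : form u v + (form u v)^* <= `|form u v| *+ 2.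
  have -> : form u v + (form u v)^* = 'Re (form u v) *+ 2.
    by rewrite ReE -mulr_natr divfK ?pnatr_eq0.
  rewrite lerMn2r /=; exact: (leif_Re_Creal _).1.
apply: le_trans H1 _; rewrite lerMn2r /= -[leLHS]sqrCK//.
rewrite -sqrtCM ?nnegrE ?(dnorm_ge0 form)//.
rewrite ler_sqrtC ?nnegrE ?exprn_ge0 ?mulr_ge0 ?(dnorm_ge0 form)//.
exact: dot_CauchySchwarz.
Qed.

End DotTheory.

(** * Hilbert spaces of square-summable sequences *)

(* An element of l2dom is a closed subspace of the square-summable families; the
   Hilbert space l2 attached to it serves both as K and as its subspace H. *)
Record l2dom (R : realType) (F : finType) := L2Dom {
  dom :> (F -> nat -> R[i]) -> Prop;
  dom_sqs : forall x, dom x -> forall c, sqs (x c);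
  dom_0 : dom (fun _ _ => 0);
  dom_lin : forall a x y, dom x -> dom y -> dom (fun c i => a * x c i + y c i);
  dom_closed : forall y, (forall c, sqs (y c)) ->
    (forall e : R, 0 < e ->
      exists2 x, dom x & forall c, sqn (fun i => y c i - x c i) <= e) ->
    dom y
}.

Record l2 (R : realType) (F : finType) (A : l2dom R F) := L2 {
  l2v :> F -> nat -> R[i];
  l2P : A l2v
}.

Section L2.
Context {R : realType} {F : finType} {A : l2dom R F}.
Implicit Types x y z : l2 A.

Lemma l2_ext x y : (forall c i, x c i = y c i) -> x = y.
Proof.
case: x y => [x hx] [y hy] /= H.
have E : x = y by apply/funext => c; apply/funext => i.
by subst y; congr L2; exact: Prop_irrelevance.
Qed.

HB.instance Definition _ := gen_eqMixin (l2 A).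
HB.instance Definition _ := gen_choiceMixin (l2 A).

Lemma l2_sqs x c : sqs (x c). Proof. exact: dom_sqs (l2P x) c. Qed.

Lemma dom_add x y : A (fun c i => x c i + y c i).
Proof.
have := dom_lin 1 (l2P x) (l2P y); congr (dom _ _).
by apply/funext => c; apply/funext => i; rewrite mul1r.
Qed.

Lemma dom_scale a x : A (fun c i => a * x c i).
Proof.
have := dom_lin a (l2P x) (dom_0 A); congr (dom _ _).
by apply/funext => c; apply/funext => i; rewrite addr0.
Qed.

Lemma dom_opp x : A (fun c i => - x c i).
Proof.
have := dom_scale (-1) x; congr (dom _ _).
by apply/funext => c; apply/funext => i; rewrite mulN1r.
Qed.

Definition l2_zero : l2 A := L2 (dom_0 A).
Definition l2_add x y : l2 A := L2 (dom_add x y).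
Definition l2_opp x : l2 A := L2 (dom_opp x).
Definition l2_scale a x : l2 A := L2 (dom_scale a x).

Lemma l2_addA : associative l2_add.
Proof. by move=> x y z; apply: l2_ext => c i /=; rewrite addrA. Qed.
Lemma l2_addC : commutative l2_add.
Proof. by move=> x y; apply: l2_ext => c i /=; rewrite addrC. Qed.
Lemma l2_add0 : left_id l2_zero l2_add.
Proof. by move=> x; apply: l2_ext => c i /=; rewrite add0r. Qed.
Lemma l2_addN : left_inverse l2_zero l2_opp l2_add.
Proof. by move=> x; apply: l2_ext => c i /=; rewrite addNr. Qed.

HB.instance Definition _ :=
  GRing.isZmodule.Build (l2 A) l2_addA l2_addC l2_add0 l2_addN.

Lemma l2_scaleA a b x : l2_scale a (l2_scale b x) = l2_scale (a * b) x.
Proof. by apply: l2_ext => c i /=; rewrite mulrA. Qed.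
Lemma l2_scale1 : left_id 1 l2_scale.
Proof. by move=> x; apply: l2_ext => c i /=; rewrite mul1r. Qed.
Lemma l2_scaleDr : right_distributive l2_scale +%R.
Proof. by move=> a x y; apply: l2_ext => c i /=; rewrite mulrDr. Qed.
Lemma l2_scaleDl x : {morph l2_scale^~ x : a b / a + b}.
Proof. by move=> a b; apply: l2_ext => c i /=; rewrite mulrDl. Qed.

HB.instance Definition _ := GRing.Zmodule_isLmodule.Build R[i] (l2 A)
  l2_scaleA l2_scale1 l2_scaleDr l2_scaleDl.

Lemma l2E_add x y c i : (x + y) c i = x c i + y c i. Proof. by []. Qed.
Lemma l2E_opp x c i : (- x) c i = - x c i. Proof. by []. Qed.
Lemma l2E_scale a x c i : (a *: x) c i = a * x c i. Proof. by []. Qed.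
Lemma l2E_sum (I : Type) (r : seq I) (P : pred I) (G : I -> l2 A) c i :
  (\sum_(j <- r | P j) G j) c i = \sum_(j <- r | P j) G j c i.
Proof. by elim/big_rec2: _ => // j a b _ <-. Qed.

Definition l2_inner x y : R[i] := \sum_(c : F) sdot (x c) (y c).

Lemma l2_innerC x y : l2_inner x y = (-1) ^+ false * (l2_inner y x)^*%R.
Proof.
rewrite expr0 mul1r /l2_inner rmorph_sum; apply: eq_bigr => c _.
by rewrite sdotC//; exact: l2_sqs.
Qed.

Lemma l2_inner_linl y : GRing.linear_for *%R (l2_inner ^~ y).
Proof.
move=> a u v; rewrite /l2_inner mulr_sumr -big_split; apply: eq_bigr => c _.
rewrite /= sdotDl ?sdotZl//; try exact: l2_sqs.
exact/sqsZ/l2_sqs.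
Qed.

Lemma l2_inner_linr x : GRing.linear_for (@Num.conj R[i] \; *%R) (l2_inner x).
Proof.
move=> a u v; rewrite l2_innerC expr0 mul1r l2_inner_linl rmorphD rmorphM /=.
by congr (_ * _ + _); rewrite [RHS]l2_innerC expr0 mul1r.
Qed.

HB.instance Definition _ := bilinear_isBilinear.Build R[i] (l2 A) (l2 A) R[i]
  *%R (@Num.conj R[i] \; *%R) l2_inner (l2_inner_linl, l2_inner_linr).

HB.instance Definition _ := isHermitianSesquilinear.Build R[i] (l2 A) false
  (@Num.conj R[i]) l2_inner l2_innerC.

Definition nrm2 x : R := \sum_(c : F) sqn (x c).

Lemma l2_inner_nrm2 x : l2_inner x x = (nrm2 x)%:C.
Proof.
rewrite rmorph_sum; apply: eq_bigr => c _.
by rewrite sdot_sqn//; exact: l2_sqs.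
Qed.

Lemma sqn_nrm2 x c : sqn (x c) <= nrm2 x.
Proof.
rewrite /nrm2 (bigD1 c)//= lerDl; apply: sumr_ge0 => d _.
exact/sqn_ge0/l2_sqs.
Qed.

Lemma nrm2_ge0 x : 0 <= nrm2 x.
Proof. by apply: sumr_ge0 => d _; exact/sqn_ge0/l2_sqs. Qed.

Lemma nm_coord x c i : nm (x c i) ^+ 2 <= nrm2 x.
Proof. exact: le_trans (nm_coord_sqn i (l2_sqs x c)) (sqn_nrm2 x c). Qed.

Lemma nrm2_eq0 x : nrm2 x = 0 -> x = 0.
Proof.
move=> h; apply: l2_ext => c i; apply/Normc.eq0_normc/eqP.
by rewrite -sqrf_eq0 eq_le sqr_ge0 andbT -h nm_coord.
Qed.

Lemma l2_inner_gt0 x : x != 0 -> 0 < l2_inner x x.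
Proof.
move=> x0; rewrite l2_inner_nrm2 ltcR lt_def nrm2_ge0 andbT.
by apply: contra_neq x0 => /nrm2_eq0.
Qed.

HB.instance Definition _ := isDotProduct.Build R[i] (l2 A) l2_inner l2_inner_gt0.

Definition l2_dot : {dot (l2 A) for @Num.conj R[i]} := l2_inner.

Definition l2_norm x : R[i] := sqrtC (l2_inner x x).

Lemma l2_normD x y : l2_norm (x + y) <= l2_norm x + l2_norm y.
Proof. exact: (dot_triangle l2_dot). Qed.

Lemma l2_normZ a x : l2_norm (a *: x) = `|a| * l2_norm x.
Proof.
rewrite /l2_norm (dnormZ l2_dot) sqrtCM ?nnegrE ?exprn_ge0 ?(dnorm_ge0 l2_dot)//.
by rewrite sqrCK.
Qed.

Lemma l2_norm_eq0 x : l2_norm x = 0 -> x = 0.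
Proof.
by move/eqP; rewrite /l2_norm sqrtC_eq0 (dnorm_eq0 l2_dot) => /eqP.
Qed.

HB.instance Definition _ := @Lmodule_isNormed.Build R[i] (l2 A) l2_norm
  l2_normD l2_normZ l2_norm_eq0.

Lemma l2_normE x : `|x| ^+ 2 = (nrm2 x)%:C.
Proof. by rewrite /Num.norm/= /l2_norm sqrtCK l2_inner_nrm2. Qed.

End L2.

(** * Real-valued norms and the topology they describe *)

Section RealNorm.
Context {R : realType} {V : normedModType R[i]}.
Implicit Types x y : V.

(** Norms take values in [R[i]]; the real part carries all the information and makes real arithmetic
    decision procedures applicable. *)
Definition nrm x : R := complex.Re `|x|.

Lemma normrE x : `|x| = (nrm x)%:C.
Proof. by rewrite RRe_real// ger0_real. Qed.

Lemma nrm_ge0 x : 0 <= nrm x.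
Proof. by rewrite -lecR -normrE normr_ge0. Qed.

Lemma nrmD x y : nrm (x + y) <= nrm x + nrm y.
Proof. by rewrite -lecR rmorphD/= -!normrE ler_normD. Qed.

Lemma nrmZ a x : nrm (a *: x) = nm a * nrm x.
Proof. by apply: (fmorph_inj (real_complex R)); rewrite rmorphM/= -!normrE normrZ normE. Qed.

Lemma nrmN x : nrm (- x) = nrm x.
Proof. by rewrite /nrm normrN. Qed.

Lemma nrmBC x y : nrm (x - y) = nrm (y - x).
Proof. by rewrite /nrm distrC. Qed.

Lemma nrm_eq0 x : nrm x = 0 -> x = 0.
Proof. by move=> h; apply/normr0_eq0; rewrite normrE h. Qed.

Lemma posC (e : R[i]) : 0 < e -> 0 < complex.Re e /\ e = (complex.Re e)%:C.
Proof. by case: e => a b; rewrite ltcE/= => /andP[/eqP -> ->]. Qed.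

Lemma nbhs_nrmP x (P : set V) :
  nbhs x P <-> exists2 e : R, 0 < e & forall y, nrm (x - y) < e -> P y.
Proof.
split=> [/nbhs_ballP[e /posC[e0 ->] H]|[e e0 H]].
  exists (complex.Re e) => // y h; apply: H.
  by rewrite -ball_normE/= normrE ltcR.
apply/nbhs_ballP; exists e%:C; first by rewrite /= ltcR.
by move=> y; rewrite -ball_normE/= normrE ltcR; exact: H.
Qed.

Lemma closureP (B : set V) x :
  closure B x <-> forall e : R, 0 < e -> exists2 y, B y & nrm (x - y) < e.
Proof.
split=> [H e e0|H P /nbhs_nrmP[e e0 He]].
  have [|y [By h]] := H [set y | nrm (x - y) < e]; last by exists y.
  by apply/nbhs_nrmP; exists e.
by have [y By h] := H e e0; exists y; split => //; exact: He.
Qed.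

End RealNorm.

Definition invS (R : realType) (n : nat) : R := n.+1%:R^-1.

Lemma invS_gt0 (R : realType) n : 0 < invS R n.
Proof. by rewrite invr_gt0 ltr0n. Qed.

Lemma invS_le (R : realType) n m : (n <= m)%N -> invS R m <= invS R n.
Proof. by move=> h; rewrite lef_pV2 ?posrE ?ltr0n// ler_nat. Qed.

Lemma invS_le1 (R : realType) n : invS R n <= 1.
Proof. by rewrite /invS invf_le1 ?ltr0n// ler1n. Qed.

Lemma invS_small (R : realType) (e : R) : 0 < e -> exists n, invS R n < e.
Proof.
move=> e0; have e1 : 0 < e^-1 by rewrite invr_gt0.
exists (Num.bound e^-1); rewrite /invS invf_plt ?posrE ?ltr0n//.
by apply: lt_le_trans (archi_boundP (ltW e1)) _; rewrite ler_nat.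
Qed.

(** The intervals of centre [a n] and radius [d n] meet pairwise, so the supremum of their left ends
    lies in all of them. *)
Lemma real_Cauchy (R : realType) (a d : nat -> R) :
  (forall n m, `|a n - a m| <= d n + d m) ->
  exists l, forall n, `|a n - l| <= d n.
Proof.
move=> H; pose E := range (fun n => a n - d n).
have ub m : ubound E (a m + d m).
  by move=> _ [n _ <-]; have := H n m; rewrite ler_norml => /andP[h1 h2]; lra.
have hs : has_sup E by split; [exists (a 0%N - d 0%N), 0%N | exists (a 0%N + d 0%N)].
exists (sup E) => n; rewrite ler_norml; apply/andP; split.
  have : sup E <= a n + d n by apply: ge_sup => //; exact: hs.1.
  lra.
have : a n - d n <= sup E by apply: ub_le_sup; [exact: hs.2 | exists n].
lra.
Qed.

Lemma complex_Cauchy (R : realType) (z : nat -> R[i]) (d : nat -> R) :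
  (forall n m, nm (z n - z m) <= d n + d m) ->
  exists l, forall n, nm (z n - l) <= 2 * d n.
Proof.
move=> H.
have [|a Ha] := @real_Cauchy R (fun n => complex.Re (z n)) d.
  move=> n m; apply: le_trans (H n m); rewrite -raddfB; exact: Re_le_nm.
have [|b Hb] := @real_Cauchy R (fun n => complex.Im (z n)) d.
  move=> n m; apply: le_trans (H n m); rewrite -raddfB; exact: Im_le_nm.
exists (a +i* b) => n; apply: le_trans (nm_le_ReIm _) _.
by rewrite !raddfB/=; have := Ha n; have := Hb n; lra.
Qed.

(** * Completeness *)

Section L2Complete.
Context {R : realType} {F : finType} {A : l2dom R F}.
Implicit Types x y z : l2 A.

Lemma nrm_sq x : nrm x ^+ 2 = nrm2 x.
Proof. by apply: (fmorph_inj (real_complex R)); rewrite rmorphXn/= -normrE l2_normE. Qed.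

Lemma nm_coord_nrm x c i : nm (x c i) <= nrm x.
Proof. by rewrite -ler_sqr ?nnegrE ?nm_ge0 ?nrm_ge0// nrm_sq nm_coord. Qed.

(** A crude constant, which suffices to bound norms component by component. *)
Lemma nrm_le x (M : R) : 0 <= M -> (forall c, sqn (x c) <= M ^+ 2) ->
  nrm x <= #|F|%:R * M.
Proof.
move=> M0 H; rewrite -ler_sqr ?nnegrE ?nrm_ge0 ?mulr_ge0// nrm_sq.
apply: (@le_trans _ _ (#|F|%:R * M ^+ 2)).
  apply: (@le_trans _ _ (\sum_(c : F) M ^+ 2)); first by apply: ler_sum => c _; exact: H.
  by rewrite sumr_const mulr_natl.
rewrite exprMn ler_wpM2r ?sqr_ge0//.
by case: #|F| => [|n]; rewrite ?expr0n// expr2 ler_peMr// ler1n.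
Qed.

(** Balls of radius 1/(n+1) belonging to the filter give a Cauchy sequence of centres; its
    coordinatewise limit is a limit in norm, and [dom_closed] keeps it in the subspace. *)
Lemma l2_complete (G : set_system (l2 A)) : ProperFilter G -> cauchy G -> cvg G.
Proof.
move=> FG /cauchyP cG.
have /choice[x Hx] n : exists x, G (ball x (invS R n)%:C).
  by apply: cG; rewrite ltcR invS_gt0.
have xx n m : nrm (x n - x m) <= invS R n + invS R m.
  have [y []] := filter_ex (filterI (Hx n) (Hx m)); rewrite -!ball_normE/= !normrE !ltcR => h1 h2.
  have -> : x n - x m = (x n - y) - (x m - y) by rewrite opprB addrA subrK.
  by apply: le_trans (nrmD _ _) _; rewrite nrmN; lra.
have /choice[y Hy] (c : F) : exists yc : nat -> R[i],
    forall i n, nm (x n c i - yc i) <= 2 * invS R n.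
  have /choice[yc H] (i : nat) : exists l, forall n, nm (x n c i - l) <= 2 * invS R n.
    apply: complex_Cauchy => n m; apply: le_trans (xx n m).
    exact: (nm_coord_nrm (x n - x m)).
  by exists yc.
(* An intermediate [x m], with m depending on N, has coordinate errors whose squares add up to
   little over N terms. The resulting bound, 8 + 8 = 16 times [invS R n ^+ 2], does not depend on N
   and so passes to the whole series. *)
have psum n c N : \sum_(i < N) nm (x n c i - y c i) ^+ 2 <= (4 * invS R n) ^+ 2.
  have [m0 hm0] : exists m, invS R m < invS R n ^+ 2 / N.+1%:R.
    by apply: invS_small; rewrite divr_gt0 ?exprn_gt0 ?invS_gt0.
  set m := maxn n m0.
  have mn : invS R m <= invS R n by apply: invS_le; exact: leq_maxl.
  have mN : N%:R * invS R m ^+ 2 <= invS R n ^+ 2.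
    apply: (@le_trans _ _ (N.+1%:R * invS R m)); last first.
      rewrite mulrC -ler_pdivlMr ?ltr0n//; apply: le_trans (ltW hm0).
      by apply: invS_le; exact: leq_maxr.
    apply: ler_pM; rewrite ?sqr_ge0 ?ler0n ?ler_nat// expr2.
    by rewrite ler_piMr ?invS_le1// ltW ?invS_gt0.
  apply: (@le_trans _ _ (\sum_(i < N) (2 * nm (x n c i - x m c i) ^+ 2 + 8 * invS R m ^+ 2))).
    apply: ler_sum => i _.
    have -> : x n c i - y c i = (x n c i - x m c i) + (x m c i - y c i) by rewrite addrA subrK.
    apply: le_trans (nmD2 _ _) _; rewrite lerD2l.
    have : nm (x m c i - y c i) ^+ 2 <= (2 * invS R m) ^+ 2.
      by rewrite ler_sqr ?nnegrE ?nm_ge0// mulr_ge0// ltW// invS_gt0.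
    rewrite exprMn; lra.
  rewrite big_split/= -mulr_sumr sumr_const card_ord -mulr_natl.
  have h1 : \sum_(i < N) nm (x n c i - x m c i) ^+ 2 <= nrm2 (x n - x m).
    apply: le_trans (sqn_ub N (l2_sqs (x n - x m) c)) _; exact: sqn_nrm2.
  have h2 : nrm2 (x n - x m) <= (2 * invS R n) ^+ 2.
    rewrite -nrm_sq ler_sqr ?nnegrE ?nrm_ge0//.
      by apply: le_trans (xx n m) _; lra.
    by rewrite mulr_ge0// ltW// invS_gt0.
  by move: h2; rewrite !exprMn; lra.
have ysq c : sqs (y c).
  have h1 : sqs (fun i => x 0%N c i - y c i) by exists ((4 * invS R 0) ^+ 2); exact: psum.
  have := sqsD (l2_sqs (x 0%N) c) (sqsZ (-1) h1).
  by congr sqs; apply/funext => i; ring.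
have yA : A y.
  apply: dom_closed => // e e0.
  have e1 : 0 < Num.min 1 (e / 16) by rewrite lt_min ltr01 divr_gt0.
  have [n hn] := invS_small e1.
  exists (x n); first exact: l2P.
  move=> c; rewrite sqnN; apply: le_trans (sqn_le (psum n c)) _.
  rewrite exprMn; move: hn; rewrite lt_min => /andP[h1 h2].
  have := invS_gt0 R n; move: (invS R n) h1 h2 => t *; nra.
pose l : l2 A := L2 yA.
have Hl n : nrm (x n - l) <= #|F|%:R * (4 * invS R n).
  apply: nrm_le => [|c]; first by rewrite mulr_ge0// ltW// invS_gt0.
  exact: sqn_le (psum n c).
apply/cvg_ex; exists l; apply/cvgrPdist_lt => e /posC[e0 ->].
have [n hn] : exists n, invS R n < complex.Re e / (1 + #|F|%:R * 4).
  by apply: invS_small; rewrite divr_gt0// addr_gt0// mulr_ge0.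
apply: filterS (Hx n) => z; rewrite -ball_normE/= !normrE !ltcR => h.
have -> : l - z = (x n - z) - (x n - l) by rewrite opprB [RHS]addrC addrA subrK.
apply: le_lt_trans (nrmD _ _) _; rewrite nrmN.
move: hn; rewrite ltr_pdivlMr ?ltr_pwDl ?mulr_ge0//.
by have := Hl n; lra.
Qed.

HB.instance Definition _ := Uniform_isComplete.Build (l2 A) l2_complete.

End L2Complete.

Lemma rat_approx (R : realType) (a e : R) : 0 < e -> exists q : rat, `|a - ratr q| < e.
Proof.
move=> e0; have [|q] := @rat_in_itvoo R (a - e) (a + e); first lra.
rewrite in_itv/= => /andP[h1 h2]; exists q; rewrite ltr_norml; lra.
Qed.

Definition ratc {R : realType} (q : rat * rat) : R[i] := ratr q.1 +i* ratr q.2.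

Lemma ratc_approx (R : realType) (z : R[i]) (e : R) :
  0 < e -> exists q, nm (z - ratc q) < e.
Proof.
move=> e0; have e2 : 0 < e / 2 by rewrite divr_gt0.
have [p hp] := rat_approx (complex.Re z) e2.
have [q hq] := rat_approx (complex.Im z) e2.
exists (p, q); apply: le_lt_trans (nm_le_ReIm _) _.
by rewrite !raddfB/=; lra.
Qed.

(** * Separability *)

Section Separable.
Context {R : realType} {F : finType} {A : l2dom R F}.

Definition ratvec (q : {ffun F -> seq (rat * rat)}) (c : F) (i : nat) : R[i] :=
  ratc (nth (0, 0) (q c) i).

Lemma sqs_ratvec q c : sqs (ratvec q c).
Proof.
apply: (@sqs_fin _ _ (size (q c))) => i hi.
by rewrite /ratvec nth_default//= /ratc /= !rmorph0.
Qed.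

Lemma ratvec_approx (x : l2 A) (e : R) : 0 < e ->
  exists q, forall c, sqn (fun i => x c i - ratvec q c i) <= e.
Proof.
move=> e0; have e2 : 0 < e / 2 by rewrite divr_gt0.
suff /choice[q Hq] (c : F) : exists q : seq (rat * rat),
    sqn (fun i => x c i - ratc (nth (0, 0) q i)) <= e.
  exists (finfun q) => c; move: (Hq c); congr (sqn _ <= _).
  by apply/funext => i; rewrite /ratvec ffunE.
have [N /(_ N (leqnn _)) HN] := sqn_tail (l2_sqs x c) e2.
pose d := Num.min 1 (e / 2 / N.+1%:R).
have d0 : 0 < d by rewrite lt_min ltr01 divr_gt0.
have /choice[f Hf] (i : nat) := ratc_approx (x c i) d0.
exists (mkseq f N); apply: sqn_le => n.
have tl : sqs (fun i => if (i < N)%N then 0 else x c i).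
  by apply: (sqs_le (c := 1) (l2_sqs x c)) => i; rewrite mul1r; case: ifP; rewrite ?Normc.normc0 ?nm_ge0.
apply: (@le_trans _ _ (\sum_(i < n) ((if (i < N)%N then d else 0) +
     nm (if (i < N)%N then 0 else x c i) ^+ 2))).
  apply: ler_sum => i _; have [iN|Ni] := ltnP i N; last first.
    by rewrite nth_default ?size_mkseq// /ratc/= !rmorph0 subr0 add0r.
  rewrite nth_mkseq// Normc.normc0 expr0n addr0.
  apply: (@le_trans _ _ (d ^+ 2)).
    by rewrite ler_sqr ?nnegrE ?nm_ge0 ?ltW.
  by rewrite expr2 ler_piMr ?(ltW d0)// /d ge_min lexx.
rewrite big_split/=.
have h1 := le_trans (sqn_ub n tl) HN.
have h2 : \sum_(i < n) (if (i < N)%N then d else 0) <= e / 2.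
  apply: (@le_trans _ _ (\sum_(i < maxn n N) (if (i < N)%N then d else 0))).
    apply: (@sum_ord_widen R (fun i => if (i < N)%N then d else 0)) => [|i].
      exact: leq_maxl.
    by case: ifP => // _; exact: ltW.
  rewrite (@sum_ord_widen0 R (fun i => if (i < N)%N then d else 0) N) ?leq_maxr//.
    rewrite (eq_bigr (fun=> d)); last by move=> i _; rewrite ltn_ord.
    rewrite sumr_const card_ord -[d *+ N]mulr_natl.
    have : d <= e / 2 / N.+1%:R by rewrite /d ge_min lexx orbT.
    rewrite ler_pdivlMr ?ltr0n// => h; apply: le_trans h.
    by rewrite mulrC ler_wpM2l ?(ltW d0)// ler_nat.
  by move=> i; rewrite leqNgt => /negbTE ->.
lra.
Qed.

(** Finitely supported rational families need not belong to the subspace. Each pair of such a family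
    and a precision is replaced by a chosen point of the subspace within that precision, or by the
    default 0 when there is none. *)
Lemma l2_separable : exists2 D : set (l2 A), countable D & dense D.
Proof.
pose T := ({ffun F -> seq (rat * rat)} * nat)%type.
pose near (t : T) (x : l2 A) :=
  forall c, sqn (fun i => x c i - ratvec t.1 c i) <= invS R t.2 ^+ 2.
pose g (t : T) : l2 A := xget 0 [set x | near t x].
exists (range g).
  exact: sub_countable (card_image_le g setT) (countableP _).
move=> O [x Ox] oO.
have /nbhs_nrmP[e e0 He] : nbhs x O by exact: open_nbhs_nbhs.
have [n hn] : exists n, invS R n < e / (#|F|%:R * 2 + 1).
  by apply: invS_small; rewrite divr_gt0// ltr_wpDl ?mulr_ge0.
have [q Hq] := ratvec_approx x (exprn_gt0 2 (invS_gt0 R n)).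
have gn : near (q, n) (g (q, n)) by rewrite /g; case: xgetP => [y -> //|/(_ x)].
exists (g (q, n)); split; last by exists (q, n).
apply: He; apply: (@le_lt_trans _ _ (#|F|%:R * (2 * invS R n))).
  apply: nrm_le => [|c]; first by rewrite mulr_ge0// ltW// invS_gt0.
  apply: sqn_le => N.
  have s1 : sqs (fun i => x c i - ratvec q c i).
    have := sqsD (l2_sqs x c) (sqsZ (-1) (sqs_ratvec q c)).
    by congr sqs; apply/funext => i; rewrite mulN1r.
  have s2 : sqs (fun i => g (q, n) c i - ratvec q c i).
    have := sqsD (l2_sqs (g (q, n)) c) (sqsZ (-1) (sqs_ratvec q c)).
    by congr sqs; apply/funext => i; rewrite mulN1r.
  have := le_trans (sqn_ub N s1) (Hq c).
  have := le_trans (sqn_ub N s2) (gn c).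
  move=> h1 h2; apply: (@le_trans _ _ (2 * \sum_(i < N) nm (x c i - ratvec q c i) ^+ 2 +
     2 * \sum_(i < N) nm (g (q, n) c i - ratvec q c i) ^+ 2)).
    rewrite !mulr_sumr -big_split; apply: ler_sum => i _ /=.
    rewrite -[X in _ <= _ + 2 * X ^+ 2]nmN; apply: le_trans (nmD2 _ _).
    by rewrite opprB addrA subrK.
  rewrite exprMn; lra.
move: hn; rewrite ltr_pdivlMr ?ltr_wpDl ?mulr_ge0//.
have := invS_gt0 R n; nra.
Qed.

Lemma l2_inner_norm (x : l2 A) : l2_dot x x = `|x| ^+ 2.
Proof. by rewrite l2_normE -l2_inner_nrm2. Qed.

Definition l2_hilbert : hilbertType R := HilbertType l2_inner_norm l2_separable.

End Separable.

(** * Orthogonal projections *)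

Section HilbertTheory.
Context {R : realType} {H : hilbertType R}.
Implicit Types (x y z : H) (L : set H).

Lemma inner_nrm x : inner H x x = (nrm x ^+ 2)%:C.
Proof. by rewrite inner_norm normrE rmorphXn. Qed.

Lemma inner_CS x y : nm (inner H x y) <= nrm x * nrm y.
Proof.
have := dot_CauchySchwarz (inner H) x y.
rewrite !inner_nrm normE -rmorphXn -rmorphM/= lecR -exprMn ler_sqr//.
  by rewrite nnegrE nm_ge0.
by rewrite nnegrE mulr_ge0 ?nrm_ge0.
Qed.

Lemma innerC x y : inner H x y = (inner H y x)^*.
Proof. by rewrite (hermC (inner H)) expr0 mul1r. Qed.

Lemma inner_sym0 x y : inner H x y = 0 -> inner H y x = 0.
Proof. by move=> h; rewrite innerC h rmorph0. Qed.

Lemma innerDl x y z : inner H (x + y) z = inner H x z + inner H y z.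
Proof. exact: linearDl. Qed.
Lemma innerBl x y z : inner H (x - y) z = inner H x z - inner H y z.
Proof. exact: linearBl. Qed.
Lemma innerDr x y z : inner H x (y + z) = inner H x y + inner H x z.
Proof. exact: linearDr. Qed.
Lemma innerBr x y z : inner H x (y - z) = inner H x y - inner H x z.
Proof. exact: linearBr. Qed.
Lemma innerZl a x z : inner H (a *: x) z = a * inner H x z.
Proof. exact: linearZl_LR. Qed.
Lemma innerZr a x z : inner H x (a *: z) = a^* * inner H x z.
Proof. exact: linearZr_LR. Qed.
Lemma inner0r x : inner H x 0 = 0.
Proof. exact: linear0r. Qed.
Lemma inner0l x : inner H 0 x = 0.
Proof. by rewrite innerC inner0r rmorph0. Qed.

Lemma parallelogram x y :
  nrm (x + y) ^+ 2 + nrm (x - y) ^+ 2 = 2 * nrm x ^+ 2 + 2 * nrm y ^+ 2.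
Proof.
have E : inner H (x + y) (x + y) + inner H (x - y) (x - y) =
    inner H x x + inner H x x + (inner H y y + inner H y y).
  rewrite innerDl !(innerDr _ x y) innerBl !(innerBr _ x y).
  by move: (inner H x x) (inner H x y) (inner H y x) (inner H y y) => *; ring.
move: E; rewrite !inner_nrm -!rmorphD => /(fmorph_inj (real_complex R)) E.
by rewrite /= in E *; lra.
Qed.

Lemma seq_complete (y : nat -> H) :
  (forall n m, nrm (y n - y m) <= invS R n + invS R m) ->
  exists l, forall n, nrm (y n - l) <= 2 * invS R n.
Proof.
move=> Hy.
have : cvg (y @ \oo).
  apply/cauchy_cvgP/cauchyP => e /posC[e0 ->].
  have [n hn] : exists n, invS R n < complex.Re e / 2.
    by apply: invS_small; rewrite divr_gt0.
  exists (y n); exists n => // m /= nm; rewrite -ball_normE/= normrE ltcR.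
  by have := Hy n m; have := invS_le R nm; lra.
move=> /cvg_ex[l /cvgrPdist_lt Hl]; exists l => n.
apply/ler_addgt0Pr => e e0.
have [|N _ HN] := Hl e%:C; first by rewrite ltcR.
have := HN (maxn n N) (leq_maxr _ _); rewrite normrE ltcR => h.
have -> : y n - l = (y n - y (maxn n N)) - (l - y (maxn n N)).
  by rewrite opprB addrA subrK.
apply: le_trans (nrmD _ _) _; rewrite nrmN.
by have := Hy n (maxn n N); have := invS_le R (leq_maxl n N); lra.
Qed.

Lemma subspace_0 L : closed_subspace L -> L 0.
Proof. by case. Qed.
Lemma subspace_D L x y : closed_subspace L -> L x -> L y -> L (x + y).
Proof. by case=> _ h _ Lx Ly; have := h 1 x y Lx Ly; rewrite scale1r. Qed.
Lemma subspace_Z L a x : closed_subspace L -> L x -> L (a *: x).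
Proof. by case=> h0 h _ Lx; have := h a x 0 Lx h0; rewrite addr0. Qed.
Lemma subspace_B L x y : closed_subspace L -> L x -> L y -> L (x - y).
Proof.
by move=> hL Lx Ly; rewrite -scaleN1r; apply: subspace_D => //; exact: subspace_Z.
Qed.

(** If x - l had a nonzero component t w along some w in L, moving l by t w would bring it strictly
    closer to x, by Pythagoras. *)
Lemma nearest_orthogonal L x l : closed_subspace L -> L l ->
  (forall y, L y -> nrm (x - l) ^+ 2 <= nrm (x - y) ^+ 2) ->
  orthogonal_complement L (x - l).
Proof.
move=> hL Ll Hmin w Lw; have [->|w0] := eqVneq w 0; first exact: inner0l.
apply: inner_sym0; set v := x - l; have ww : inner H w w != 0 by rewrite dnorm_eq0.
set t := inner H v w / inner H w w.
have tw : inner H (v - t *: w) w = 0 by rewrite innerBl innerZl divfK ?subrr.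
have E : nrm v ^+ 2 = nrm (v - t *: w) ^+ 2 + (nm t * nrm w) ^+ 2.
  have O : inner H (v - t *: w) (t *: w) = 0 by rewrite innerZr tw mulr0.
  have := hnormDd O; rewrite subrK => O'.
  have : inner H v v = inner H (v - t *: w) (v - t *: w) + inner H (t *: w) (t *: w).
    exact: O'.
  rewrite !inner_nrm -rmorphD nrmZ.
  by move/(fmorph_inj (real_complex R)).
have := Hmin (l + t *: w) (subspace_D hL Ll (subspace_Z _ hL Lw)).
rewrite opprD addrA -/v E gerDl => h.
have /eqP : (nm t * nrm w) ^+ 2 = 0 by apply/eqP; rewrite eq_le h sqr_ge0.
rewrite sqrf_eq0 mulf_eq0 => /orP[/eqP/Normc.eq0_normc t0|/eqP/nrm_eq0 w1].
  by have := divfK ww (inner H v w); rewrite -/t t0 mul0r.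
by rewrite w1 eqxx in w0.
Qed.

Lemma projection L x : closed_subspace L ->
  exists2 y, L y & orthogonal_complement L (x - y).
Proof.
move=> hL; pose E := [set nrm (x - y) ^+ 2 | y in L].
have E0 : E !=set0 by exists (nrm (x - 0) ^+ 2), 0 => //; exact: subspace_0.
have Elb : lbound E 0 by move=> _ [y _ <-]; exact: sqr_ge0.
have hE : has_inf E by split => //; exists 0.
set D := inf E.
have DE y : L y -> D <= nrm (x - y) ^+ 2.
  by move=> Ly; apply: ge_inf; [exact: hE.2|exists y].
have D0 : 0 <= D by apply: lb_le_inf.
(* With this excess over the infimum, the parallelogram law bounds the squared distance of [y n] and
   [y m] by [invS R n ^+ 2 + invS R m ^+ 2]. *)
have /choice[y Hy] n : exists y, L y /\ nrm (x - y) ^+ 2 <= D + invS R n ^+ 2 / 2.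
  have e0 : 0 < invS R n ^+ 2 / 2 by rewrite divr_gt0 ?exprn_gt0 ?invS_gt0.
  have [_ [y Ly <-] h] := inf_adherent e0 hE.
  by exists y; split => //; exact: ltW.
have [|l Hl] := @seq_complete y.
  move=> n m; have [Ln hn] := Hy n; have [Lm hm] := Hy m.
  have L2 : L (2^-1 *: (y n + y m)).
    by apply: subspace_Z => //; exact: subspace_D.
  have := DE _ L2; have := parallelogram (x - y n) (x - y m).
  have -> : x - y n + (x - y m) = 2 *: (x - 2^-1 *: (y n + y m)).
    rewrite scalerBr scalerA mulfV ?pnatr_eq0// scale1r scaler_nat mulr2n opprD.
    by rewrite addrACA.
  have -> : x - y n - (x - y m) = - (y n - y m) by rewrite opprB !opprB addrC addrA subrK.
  rewrite nrmN nrmZ exprMn => h1 h2.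
  have nm2 : nm (2 : R[i]) = 2.
    by have := nm_real (2 : R); rewrite rmorph_nat ger0_norm.
  rewrite nm2 in h1.
  have dn := invS_gt0 R n; have dm := invS_gt0 R m.
  rewrite -ler_sqr ?nnegrE ?nrm_ge0 ?addr_ge0 ?ltW// sqrrD.
  have := mulr_gt0 dn dm; lra.
have Ll : L l.
  case: hL => _ _ /closure_id ->; apply/closureP => e e0.
  have [n hn] : exists n, invS R n < e / 2 by apply: invS_small; rewrite divr_gt0.
  exists (y n); first by have [] := Hy n.
  by rewrite nrmBC; have := Hl n; lra.
exists l => //; apply: nearest_orthogonal => // z Lz.
apply: le_trans (DE z Lz); apply/ler_addgt0Pr => e e0.
have K0 : 0 < 5 + 4 * (D + 1) by lra.
have [n hn] := invS_small (divr_gt0 e0 K0).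
move: hn; rewrite ltr_pdivlMr// => hn.
have [_ h1] := Hy n; have h2 := Hl n.
have dn := invS_gt0 R n; have dn1 := invS_le1 R n.
have h3 : nrm (x - l) <= nrm (x - y n) + 2 * invS R n.
  have -> : x - l = (x - y n) + (y n - l) by rewrite addrA subrK.
  by apply: le_trans (nrmD _ _) _; lra.
have dd : invS R n ^+ 2 <= invS R n by rewrite expr2 ler_piMr// ltW.
have h4 : nrm (x - y n) <= D + 1.
  rewrite -ler_sqr ?nnegrE ?nrm_ge0//; last lra.
  by rewrite sqrrD; have := sqr_ge0 D; lra.
apply: (@le_trans _ _ ((nrm (x - y n) + 2 * invS R n) ^+ 2)).
  by rewrite ler_sqr ?nnegrE ?nrm_ge0// addr_ge0 ?nrm_ge0// mulr_ge0// ltW.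
rewrite sqrrD exprMn.
have : nrm (x - y n) * (2 * invS R n) <= (D + 1) * (2 * invS R n).
  by rewrite ler_wpM2r// mulr_ge0// ltW.
lra.
Qed.

Lemma subspace_full L : closed_subspace L ->
  (forall y, orthogonal_complement L y -> y = 0) -> L = setT.
Proof.
move=> hL h; apply/seteqP; split => // x _.
by have [y Ly /h/eqP] := projection x hL; rewrite subr_eq0 => /eqP ->.
Qed.

Lemma orthogonal_closed L : closed_subspace (orthogonal_complement L).
Proof.
split=> [x _|a x y hx hy z Lz|]; first exact: inner0r.
  by rewrite innerDr innerZr hx// hy// mulr0 addr0.
apply/closure_id/seteqP; split; first exact: subset_closure.
move=> y /closureP hy z Lz; apply: small_eq0 => e e0.
have z1 : 0 < nrm z + 1 by have := nrm_ge0 z; lra.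
have [w hw] := hy _ (divr_gt0 e0 z1); rewrite ltr_pdivlMr// => h.
have -> : inner H z y = inner H z (y - w) by rewrite innerBr (hw z Lz) subr0.
by apply: le_trans (inner_CS _ _) _; have := nrm_ge0 (y - w); nra.
Qed.

Lemma closure_subspace (W : set H) : W 0 ->
  (forall a x y, W x -> W y -> W (a *: x + y)) -> closed_subspace (closure W).
Proof.
move=> W0 hW; split; [exact: subset_closure| |exact: closed_closure].
move=> a x y /closureP hx /closureP hy; apply/closureP => e e0.
have a1 : 0 < nm a + 1 by have := nm_ge0 a; lra.
have e2 : 0 < e / 2 by rewrite divr_gt0.
have [x' Wx] := hx _ (divr_gt0 e2 a1); rewrite ltr_pdivlMr// => h1.
have [y' Wy h2] := hy _ e2.
exists (a *: x' + y'); first exact: hW.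
rewrite opprD addrACA -scalerBr; apply: le_lt_trans (nrmD _ _) _; rewrite nrmZ.
by have := nrm_ge0 (x - x'); nra.
Qed.

End HilbertTheory.

(** * Choice of the nodes *)

Section Nodes.
Context {R : realType}.

Definition half : R[i] := (2^-1)%:C.

Lemma dense_nodes : exists lam : nat -> R[i],
  [/\ injective lam, forall k, nm (lam k - half) < 8^-1
    & forall z (e : R), nm (z - half) < 8^-1 -> 0 < e ->
        exists k, 0 < nm (lam k - z) < e].
Proof.
pose B := [set q : rat * rat | nm (@ratc R q - half) < 8^-1].
(* These points show that the disc has infinitely many rational points, which can then be enumerated
   by [nat] without repetition. *)
pose f (n : nat) : rat * rat := (2^-1 + (16%:R * n.+1%:R)^-1, 0).
have fB n : B (f n).
  have -> : B (f n) = (nm ((16%:R * n.+1%:R)^-1%:C : R[i]) < 8^-1).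
    rewrite /B /= /ratc /half /=; congr (Num.sqrt (_ ^+ 2 + _ ^+ 2) < _).
      by rewrite rmorphD !fmorphV rmorphM !rmorph_nat addrAC subrr add0r.
    by rewrite rmorph0 oppr0 addr0.
  rewrite nm_real ger0_norm ?invr_ge0 ?mulr_ge0//.
  rewrite ltf_pV2 ?posrE ?mulr_gt0 ?ltr0n//.
  have : (1 : R) <= n.+1%:R by rewrite ler1n.
  lra.
have f_inj : injective f.
  move=> n m [] /addrI/invr_inj/(mulfI _) h.
  by apply: succn_inj; apply/eqP; rewrite -(eqr_nat rat); apply/eqP/h.
have Binf : infinite_set B.
  apply/infiniteP; apply: card_le_trans (subset_card_le (_ : range f `<=` B)).
    have : (range f #= [set: nat])%card by apply: inj_card_eq => x y _ _; exact: f_inj.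
    by rewrite card_eq_le => /andP[].
  by move=> _ [n _ <-].
have /card_esym/card_set_bijP[g [gB g_inj g_surj]] := eq_card_nat (countableP B) Binf.
exists (fun k => ratc (g k)); split.
- move=> n m; rewrite /ratc => -[] /fmorph_inj h1 /fmorph_inj h2.
  apply: g_inj; rewrite ?inE//.
  by rewrite [g n]surjective_pairing [g m]surjective_pairing h1 h2.
- by move=> k; exact: gB.
move=> z e zB e0; set rho := 8^-1 - nm (z - half).
have rho0 : 0 < rho by rewrite subr_gt0.
pose d := Num.min e rho / 2.
have d0 : 0 < d by rewrite divr_gt0// lt_min e0.
have de : 2 * d <= e by rewrite /d mulrC divfK ?pnatr_eq0// ge_min lexx.
have dr : 2 * d <= rho by rewrite /d mulrC divfK ?pnatr_eq0// ge_min lexx orbT.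
(* Since z may itself be a node, z + d is approximated instead of z: an error below d/2 leaves the
   node at distance between d/2 and 3d/2 from z. *)
have [q hq] := ratc_approx (z + d%:C) (divr_gt0 d0 (ltr0n R 2)).
have nd : nm (d%:C : R[i]) = d by rewrite nm_real ger0_norm// ltW.
have h1 : nm (ratc q - z) <= d + d / 2.
  have -> : ratc q - z = d%:C - (z + d%:C - ratc q) by ring.
  by apply: le_trans (nmB _ _) _; rewrite nd lerD2l ltW.
have h2 : d / 2 < nm (ratc q - z).
  have : nm (d%:C : R[i]) <= nm (ratc q - z) + nm (z + d%:C - ratc q).
    have {1}-> : d%:C = (ratc q - z) + (z + d%:C - ratc q) by ring.
    exact: nmD.
  rewrite nd; lra.
have qB : B q.
  suff : nm (ratc q - half) < 8^-1 by [].
  have -> : ratc q - half = (ratc q - z) + (z - half) by ring.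
  by apply: le_lt_trans (nmD _ _) _; rewrite /rho in dr; lra.
have [k _ gk] := g_surj q qB.
exists k; rewrite gk; apply/andP; split; lra.
Qed.

(** Among the first N nodes, those different from z stay at some distance d from it; a node closer
    than d and different from z has index at least N. *)
Lemma nodes_tail (lam : nat -> R[i]) z (N : nat) :
  (forall e : R, 0 < e -> exists k, 0 < nm (lam k - z) < e) ->
  forall e : R, 0 < e -> exists2 k, (N <= k)%N & 0 < nm (lam k - z) < e.
Proof.
move=> H; suff [d d0 Hd] : exists2 d : R, 0 < d &
    forall k, (k < N)%N -> 0 < nm (lam k - z) -> d <= nm (lam k - z).
  move=> e e0; have [|k /andP[k0]] := H (Num.min e d); first by rewrite lt_min e0.
  rewrite lt_min => /andP[ke kd]; exists k; last by rewrite k0.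
  by rewrite leqNgt; apply/negP => /Hd /(_ k0); rewrite leNgt kd.
elim: N => [|N [d d0 Hd]]; first by exists 1.
have [lN|lN] := ltP 0 (nm (lam N - z)).
  exists (Num.min d (nm (lam N - z))); first by rewrite lt_min d0.
  move=> k; rewrite ltnS leq_eqVlt => /orP[/eqP ->|kN] h.
    by rewrite ge_min lexx orbT.
  by rewrite ge_min Hd.
exists d => // k; rewrite ltnS leq_eqVlt => /orP[/eqP ->|kN] h; last exact: Hd.
by move: h; rewrite ltNge lN.
Qed.

Lemma geom_le (q : R) n : 0 <= q -> q < 1 -> \sum_(i < n) q ^+ i <= (1 - q)^-1.
Proof.
move=> q0 q1; have h : 0 < 1 - q by rewrite subr_gt0.
rewrite -[leRHS]mul1r ler_pdivlMr// mulrC.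
have -> : (1 - q) * \sum_(i < n) q ^+ i = 1 - q ^+ n.
  rewrite -{2}(expr1n R n) subrXX; congr (_ * _); apply: eq_bigr => i _.
  by rewrite expr1n mul1r.
by rewrite gerBl exprn_ge0.
Qed.

End Nodes.

(** * The model *)

(* A vector of K is a 5-tuple (a, b, u, c, d) of sequences: f(z) = sum_n a_n z^n +
   sum_n b_n z^(-n-1) is the component in the first L^2(T), u the one in l^2, and
   (c, d) encodes in the same way the component g in the second L^2(T). *)
Definition iA : 'I_5 := @Ordinal 5 0 isT.
Definition iB : 'I_5 := @Ordinal 5 1 isT.
Definition iU : 'I_5 := @Ordinal 5 2 isT.
Definition iC : 'I_5 := @Ordinal 5 3 isT.
Definition iD : 'I_5 := @Ordinal 5 4 isT.

Lemma ord5_cases (P : 'I_5 -> Prop) :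
  P iA -> P iB -> P iU -> P iC -> P iD -> forall c, P c.
Proof.
move=> ha hb hu hc hd [[|[|[|[|[|//]]]]] h]; [move: ha|move: hb|move: hu|move: hc|move: hd];
  by congr P; exact: val_inj.
Qed.

Lemma sum_ord5 (V : zmodType) (f : 'I_5 -> V) :
  \sum_(c : 'I_5) f c = f iA + f iB + f iU + f iC + f iD.
Proof.
rewrite !big_ord_recl big_ord0 addr0 !addrA.
by congr (f _ + f _ + f _ + f _ + f _); exact: val_inj.
Qed.

Section Model.
Context {R : realType}.
Notation vec := ('I_5 -> nat -> R[i]).

Definition mk5 (a b u c d : nat -> R[i]) : vec := fun i =>
  match val i with 0%N => a | 1%N => b | 2%N => u | 3%N => c | _ => d end.

Definition scons (z : R[i]) (x : nat -> R[i]) (n : nat) : R[i] :=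
  if n is m.+1 then x m else z.

Definition full_dom (x : vec) : Prop := forall c, sqs (x c).

Lemma full_dom_0 : full_dom (fun _ _ => 0). Proof. by move=> c; exact: sqs0. Qed.

Lemma full_dom_lin a x y : full_dom x -> full_dom y ->
  full_dom (fun c i => a * x c i + y c i).
Proof. by move=> hx hy c; apply: sqsD => //; exact: sqsZ. Qed.

Definition Kdom : l2dom R 'I_5 :=
  L2Dom (fun x hx => hx) full_dom_0 full_dom_lin (fun y hy _ => hy).

(** * The normal operator on K and its adjoint *)

Section Operator.
Context (lam : nat -> R[i]).

Definition quarter : R[i] := (4^-1)%:C.

Lemma conj_quarter : quarter^* = quarter.
Proof. by apply: conj_Creal; apply/complex_realP; exists 4^-1. Qed.

Lemma nm_quarter : nm quarter = 4^-1.
Proof. by rewrite /quarter nm_real ger0_norm. Qed.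

(** Multiplication by z sends the coefficient of 1/z, stored at index 0 of [iB] or [iD], to the
    constant term of the nonnegative part. *)
Definition shift5 (x : vec) : vec :=
  mk5 (scons (x iB 0%N) (x iA)) (fun n => x iB n.+1)
      (fun k => lam k * x iU k)
      (fun n => quarter * scons (x iD 0%N) (x iC) n)
      (fun n => quarter * x iD n.+1).

(** The adjoint of [shift5]: on the unit circle the conjugate of z is 1/z, so both bilateral shifts
    run backwards. *)
Definition cshift5 (x : vec) : vec :=
  mk5 (fun n => x iA n.+1) (scons (x iA 0%N) (x iB))
      (fun k => (lam k)^* * x iU k)
      (fun n => quarter * x iC n.+1)
      (fun n => quarter * scons (x iC 0%N) (x iD) n).

Lemma shift5_lin a (x y : vec) c i :
  shift5 (fun c i => a * x c i + y c i) c i = a * shift5 x c i + shift5 y c i.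
Proof.
by move: c; apply: ord5_cases; case: i => [|i]; rewrite /shift5/mk5/=; ring.
Qed.

Lemma cshift5_lin a (x y : vec) c i :
  cshift5 (fun c i => a * x c i + y c i) c i = a * cshift5 x c i + cshift5 y c i.
Proof.
by move: c; apply: ord5_cases; case: i => [|i]; rewrite /cshift5/mk5/=; ring.
Qed.

Context (lam1 : forall k, nm (lam k) <= 1).

Lemma sqn_scons z x : sqs x -> sqn (scons z x) <= nm z ^+ 2 + sqn x.
Proof.
move=> hx; apply: sqn_le => -[|n]; first by rewrite big_ord0 addr_ge0 ?sqr_ge0 ?sqn_ge0.
by rewrite big_ord_recl lerD2l; exact: sqn_ub.
Qed.

Lemma sqn_shift (x : nat -> R[i]) : sqs x -> sqn (fun n => x n.+1) <= sqn x.
Proof.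
move=> hx; apply: sqn_le => n; apply: le_trans (sqn_ub n.+1 hx).
by rewrite [leRHS]big_ord_recl lerDr sqr_ge0.
Qed.

Lemma sqn_mul (t x : nat -> R[i]) : sqs x -> (forall i, nm (t i) <= 1) ->
  sqn (fun i => t i * x i) <= sqn x.
Proof.
move=> hx ht; apply: sqn_le => n; apply: le_trans (sqn_ub n hx).
apply: ler_sum => i _; rewrite Normc.normcM ler_sqr ?nnegrE ?mulr_ge0 ?nm_ge0//.
by rewrite ler_piMl ?nm_ge0.
Qed.

Lemma sqs_scons z x : sqs x -> sqs (scons z x).
Proof. exact: sqs_cons. Qed.

Lemma shift5_sqs x : full_dom x -> full_dom (shift5 x).
Proof.
move=> hx; apply: ord5_cases; rewrite /shift5/mk5/=.
- exact: sqs_scons.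
- exact: sqsS (hx iB).
- exact: sqs_mul lam1 (hx iU).
- by apply: sqsZ; exact: sqs_scons.
- by apply: sqsZ; exact: sqsS (hx iD).
Qed.

Lemma cshift5_sqs x : full_dom x -> full_dom (cshift5 x).
Proof.
move=> hx; apply: ord5_cases; rewrite /cshift5/mk5/=.
- exact: sqsS (hx iA).
- exact: sqs_scons.
- by apply: (sqs_mul (c := 1)) => // k; rewrite nmJ.
- by apply: sqsZ; exact: sqsS (hx iC).
- by apply: sqsZ; exact: sqs_scons.
Qed.

Lemma quarter_le1 : nm quarter <= 1. Proof. by rewrite nm_quarter; lra. Qed.

Lemma shift5_bound x (M : R) : full_dom x -> (forall c, sqn (x c) <= M ^+ 2) ->
  forall c, sqn (shift5 x c) <= (2 * M) ^+ 2.
Proof.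
move=> hx HM.
have M2 : 2 * M ^+ 2 <= (2 * M) ^+ 2 by rewrite exprMn; have := sqr_ge0 M; lra.
have M1 : M ^+ 2 <= (2 * M) ^+ 2 by rewrite exprMn; have := sqr_ge0 M; lra.
have HS z y : sqs y -> nm z ^+ 2 <= M ^+ 2 -> sqn y <= M ^+ 2 -> sqn (scons z y) <= (2 * M) ^+ 2.
  by move=> hy hz hyM; apply: le_trans (sqn_scons z hy) _; lra.
have H0 c : nm (x c 0%N) ^+ 2 <= M ^+ 2 by exact: le_trans (nm_coord_sqn 0 (hx c)) (HM c).
apply: ord5_cases; rewrite /shift5/mk5/=.
- exact: HS.
- by apply: le_trans (sqn_shift (hx iB)) _; apply: le_trans (HM iB) _.
- by apply: le_trans (sqn_mul (hx iU) lam1) _; apply: le_trans (HM iU) _.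
- apply: le_trans (HS _ _ (hx iC) (H0 iD) (HM iC)).
  by apply: (sqn_mul (t := fun=> quarter)) => [|_]; [exact: sqs_scons | exact: quarter_le1].
- apply: le_trans M1; apply: le_trans (HM iD); apply: le_trans (sqn_shift (hx iD)).
  by apply: (sqn_mul (t := fun=> quarter)) => [|_]; [exact: sqsS (hx iD) | exact: quarter_le1].
Qed.

Lemma cshift5_bound x (M : R) : full_dom x -> (forall c, sqn (x c) <= M ^+ 2) ->
  forall c, sqn (cshift5 x c) <= (2 * M) ^+ 2.
Proof.
move=> hx HM.
have M2 : 2 * M ^+ 2 <= (2 * M) ^+ 2 by rewrite exprMn; have := sqr_ge0 M; lra.
have M1 : M ^+ 2 <= (2 * M) ^+ 2 by rewrite exprMn; have := sqr_ge0 M; lra.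
have HS z y : sqs y -> nm z ^+ 2 <= M ^+ 2 -> sqn y <= M ^+ 2 -> sqn (scons z y) <= (2 * M) ^+ 2.
  by move=> hy hz hyM; apply: le_trans (sqn_scons z hy) _; lra.
have H0 c : nm (x c 0%N) ^+ 2 <= M ^+ 2 by exact: le_trans (nm_coord_sqn 0 (hx c)) (HM c).
apply: ord5_cases; rewrite /cshift5/mk5/=.
- by apply: le_trans (sqn_shift (hx iA)) _; apply: le_trans (HM iA) _.
- exact: HS.
- apply: le_trans (sqn_mul (hx iU) _) _ => [k|]; first by rewrite nmJ.
  exact: le_trans (HM iU) _.
- apply: le_trans M1; apply: le_trans (HM iC); apply: le_trans (sqn_shift (hx iC)).
  by apply: (sqn_mul (t := fun=> quarter)) => [|_]; [exact: sqsS (hx iC) | exact: quarter_le1].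
- apply: le_trans (HS _ _ (hx iD) (H0 iC) (HM iD)).
  by apply: (sqn_mul (t := fun=> quarter)) => [|_]; [exact: sqs_scons | exact: quarter_le1].
Qed.

Lemma sdot_scons a b x y : sqs x -> sqs y ->
  sdot (scons a x) (scons b y) = a * b^* + sdot x y.
Proof. by move=> hx hy; rewrite sdotS//; exact: sqs_scons. Qed.

Lemma shift5_adjoint x y : full_dom x -> full_dom y ->
  \sum_(c : 'I_5) sdot (shift5 x c) (y c) = \sum_(c : 'I_5) sdot (x c) (cshift5 y c).
Proof.
move=> hx hy; rewrite !sum_ord5 /shift5 /cshift5 /mk5 /=.
have scE (z : nat -> R[i]) : z = scons (z 0%N) (fun n => z n.+1).
  by apply/funext => -[|n].
have ZR (z w : nat -> R[i]) : sqs z -> sqs w ->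
    sdot z (fun n => quarter * w n) = sdot (fun n => quarter * z n) w.
  move=> _ _.
  have E k : (quarter * w k)^* = quarter * (w k)^* by rewrite rmorphM/= conj_quarter.
  by congr csum; apply/funext => k; rewrite E mulrA [z k * _]mulrC.
rewrite !ZR ?sdotZl; try by [exact: hx | exact: hy | exact: sqsS (hx _) | exact: sqsS (hy _) | exact: sqs_scons].
(* Splitting off the first coordinate of exactly the unshifted sequences makes both sides expand
   into the same terms. *)
rewrite [y iA]scE [x iB]scE [y iC]scE [x iD]scE.
rewrite !sdot_scons; try by [exact: hx | exact: hy | exact: sqsS (hx _) | exact: sqsS (hy _)].
have -> : sdot (fun k => lam k * x iU k) (y iU) = sdot (x iU) (fun k => (lam k)^* * y iU k).
  by congr csum; apply/funext => k; rewrite rmorphM /= conjCK; ring.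
rewrite /=; ring.
Qed.

Lemma shift5_normal x : cshift5 (shift5 x) = shift5 (cshift5 x).
Proof.
apply/funext; apply: ord5_cases; apply/funext => -[|i];
  rewrite /shift5 /cshift5 /mk5 /=; ring.
Qed.

End Operator.
End Model.

(** Operators are given by formulas on families of sequences, so that [shift5] yields M on K and S
    on H without transport. *)
Record l2op (R : realType) (F : finType) (A B : l2dom R F) := L2Op {
  l2op_fun :> (F -> nat -> R[i]) -> (F -> nat -> R[i]);
  l2op_dom : forall x, A x -> B (l2op_fun x);
  l2op_lin : forall a x y c i,
    l2op_fun (fun c i => a * x c i + y c i) c i = a * l2op_fun x c i + l2op_fun y c i
}.

Section L2Op.
Context {R : realType} {F : finType} {A B : l2dom R F} (T : l2op A B).

Definition l2map (x : l2 A) : l2 B := L2 (l2op_dom T (l2P x)).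

Lemma l2map_linear : linear l2map.
Proof. by move=> a x y; apply: l2_ext => c i; exact: l2op_lin. Qed.

HB.instance Definition _ :=
  GRing.isLinear.Build R[i] (l2 A) (l2 B) *:%R l2map l2map_linear.

End L2Op.

Lemma nrm_bounded (R : realType) (H : hilbertType R) (T : {linear H -> H}) (M : R) :
  (forall x, nrm (T x) <= M * nrm x) -> bounded_op T.
Proof.
by move=> h; exists M%:C => x; rewrite !normrE -rmorphM/= lecR.
Qed.

Lemma geom_le2 (R : realType) (q : R) n : 0 <= q -> q <= 2^-1 -> \sum_(i < n) q ^+ i <= 2.
Proof.
move=> q0 q2; have q1 : q < 1 by lra.
apply: le_trans (geom_le n q0 q1) _.
by rewrite -[leRHS]invrK lef_pV2 ?posrE ?invr_gt0//; lra.
Qed.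

(** * The coupled subspace H and subnormality of S *)

Section Model.
Context {R : realType}.
Notation vec := ('I_5 -> nat -> R[i]).
Context (lam : nat -> R[i]).
Context (lam_half : forall k, nm (lam k - half) < 8^-1).

Lemma nm_half : nm (half : R[i]) = 2^-1.
Proof. by rewrite /half nm_real ger0_norm. Qed.

Lemma lam_le k : nm (lam k) <= 5 / 8.
Proof.
have -> : lam k = (lam k - half) + half by rewrite subrK.
by apply: le_trans (nmD _ _) _; rewrite nm_half; have := lam_half k; lra.
Qed.

Lemma lam_ge k : 3 / 8 <= nm (lam k).
Proof.
have := nmD (- (lam k - half)) (lam k); rewrite opprB subrK nm_half nmBC.
by have := lam_half k; lra.
Qed.

Lemma lam_le1 k : nm (lam k) <= 1. Proof. by have := lam_le k; lra. Qed.

(* coup u n is the coefficient of z^(-n-1) in sum_k 2^-k u_k / (z - lam k). *)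
Definition coup (u : nat -> R[i]) (n : nat) : R[i] :=
  csum (fun k => half ^+ k * lam k ^+ n * u k).

(** The factor 2 is the total weight of the 2^-k, and 5/8 bounds the modulus of the nodes. *)
Lemma coup_term (u : nat -> R[i]) (m : R) n N : (forall k, nm (u k) <= m) ->
  \sum_(k < N) nm (half ^+ k * lam k ^+ n * u k) <= 2 * m * (5 / 8) ^+ n.
Proof.
move=> hu; have m0 : 0 <= m by exact: le_trans (nm_ge0 _) (hu 0%N).
apply: (@le_trans _ _ (\sum_(k < N) (2^-1) ^+ k * (m * (5 / 8) ^+ n))).
  apply: ler_sum => k _; rewrite !Normc.normcM !nmX nm_half -mulrA.
  rewrite ler_wpM2l ?exprn_ge0 ?invr_ge0// mulrC ler_pM ?nm_ge0 ?exprn_ge0 ?nm_ge0//.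
  by rewrite lerXn2r ?nnegrE ?nm_ge0 ?divr_ge0// lam_le.
rewrite -mulr_suml -mulrA ler_wpM2r//.
  by rewrite mulr_ge0// exprn_ge0// divr_ge0.
by apply: geom_le2.
Qed.

Lemma coup_abssum u n : sqs u -> abssum (fun k => half ^+ k * lam k ^+ n * u k).
Proof.
move=> hu; exists (2 * (sqn u + 1) * (5 / 8) ^+ n) => N; apply: coup_term => k.
have h := nm_coord_sqn k hu; have := sqn_ge0 hu; have := nm_ge0 (u k).
by have := sqr_ge0 (nm (u k) - 1); rewrite sqrrB1; nra.
Qed.

Lemma coup_le u (m : R) n : (forall k, nm (u k) <= m) ->
  nm (coup u n) <= 2 * m * (5 / 8) ^+ n.
Proof. by move=> hu; apply: nm_csum_le => N; exact: coup_term. Qed.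

Lemma coup_lin a u v n : sqs u -> sqs v ->
  coup (fun k => a * u k + v k) n = a * coup u n + coup v n.
Proof.
move=> hu hv; rewrite /coup -csumZ -?csumD; try exact: coup_abssum.
  by congr csum; apply/funext => k; ring.
by apply: abssumZ; exact: coup_abssum.
Qed.

(** The coupling intertwines diag(lam) with the backward shift of principal parts; this is what
    makes H invariant. *)
Lemma coup_lam u n : coup (fun k => lam k * u k) n = coup u n.+1.
Proof. by congr csum; apply/funext => k; rewrite exprS; ring. Qed.

Lemma coup_single u k n : (forall i, i != k -> u i = 0) ->
  coup u n = half ^+ k * lam k ^+ n * u k.
Proof. by move=> h; apply: csum_single => i /h ->; rewrite mulr0. Qed.

(** Squaring the geometric decay gives the ratio 25/64, whose series is at most 2. Only the supremum
    of u enters, so uniform smallness of u is enough later. *)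
Lemma coup_psum u (m : R) N : (forall k, nm (u k) <= m) ->
  \sum_(n < N) nm (coup u n) ^+ 2 <= 8 * m ^+ 2.
Proof.
move=> hu; have m0 : 0 <= m by exact: le_trans (nm_ge0 _) (hu 0%N).
apply: (@le_trans _ _ (\sum_(n < N) (25 / 64) ^+ n * (4 * m ^+ 2))).
  apply: ler_sum => n _; apply: (@le_trans _ _ ((2 * m * (5 / 8) ^+ n) ^+ 2)).
    by rewrite ler_sqr ?nnegrE ?nm_ge0 ?mulr_ge0 ?exprn_ge0 ?divr_ge0 ?coup_le.
  have -> : 25 / 64 = (5 / 8) ^+ 2 :> R by lra.
  rewrite exprAC; move: ((5 / 8) ^+ n) => q.
  by rewrite le_eqVlt; apply/orP; left; apply/eqP; ring.
rewrite -mulr_suml; have h := sqr_ge0 m.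
have : \sum_(n < N) (25 / 64 : R) ^+ n <= 2.
  by apply: geom_le2; lra.
nra.
Qed.

Definition at0 (z : R[i]) (n : nat) : R[i] := if n is 0%N then z else 0.

(** Membership in H on coefficients: [x iD] vanishes when g is in H^2, and the last equation
    compares negative coefficients, where 1/(z - lam k) contributes lam k ^ n to z^(-n-1). *)
Definition coupled (x : vec) : Prop :=
  [/\ forall c, sqs (x c), forall n, x iD n = 0
    & forall n, x iB n = coup (x iU) n + at0 (x iC 0%N) n].

Lemma coupled_sqs x : coupled x -> forall c, sqs (x c). Proof. by case. Qed.

Lemma coupled_0 : coupled (fun _ _ => 0).
Proof.
split => // [c|n]; first exact: sqs0.
have -> : coup (fun=> 0) n = 0 by rewrite (@coup_single _ 0%N)// mulr0.
by case: n => [|n]; rewrite /= addr0.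
Qed.

Lemma coupled_lin a x y : coupled x -> coupled y ->
  coupled (fun c i => a * x c i + y c i).
Proof.
move=> [sx dx bx] [sy dy byy]; split => [c|n|n].
- by apply: sqsD => //; exact: sqsZ.
- by rewrite dx dy mulr0 addr0.
- rewrite bx byy coup_lin//; case: n => [|n] /=; ring.
Qed.

(** The equations involve single coordinates and [coup], which is controlled by the supremum of its
    argument, so they survive uniform approximation. *)
Lemma coupled_closed (y : vec) : (forall c, sqs (y c)) ->
  (forall e : R, 0 < e ->
    exists2 x, coupled x & forall c, sqn (fun i => y c i - x c i) <= e) ->
  coupled y.
Proof.
move=> sy H.
have {}H (e : R) : 0 < e -> exists2 x, coupled x & forall c i, nm (y c i - x c i) <= e.
  move=> e0; have [x hx h] := H (e ^+ 2) (exprn_gt0 2 e0).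
  exists x => // c i; rewrite -ler_sqr ?nnegrE ?nm_ge0 ?(ltW e0)//.
  apply: le_trans (h c); apply: (nm_coord_sqn (x := fun i => y c i - x c i)).
  have := sqsD (sy c) (sqsZ (-1) (coupled_sqs hx c)).
  by congr sqs; apply/funext => j; rewrite mulN1r.
split => // n.
  apply: small_eq0 => e /H[x [_ dx _] /(_ iD n)].
  by rewrite dx subr0.
apply/eqP; rewrite -subr_eq0; apply/eqP/small_eq0 => e e0.
(* The three error terms below are at most e/4, 2(e/4) and e/4. *)
have [x [sx _ bx] h] := H (e / 4) (divr_gt0 e0 (ltr0n _ 4)).
have -> : y iB n - (coup (y iU) n + at0 (y iC 0%N) n) =
    (y iB n - x iB n) - coup (fun k => -1 * x iU k + y iU k) n
    - at0 (y iC 0%N - x iC 0%N) n.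
  by rewrite coup_lin// bx; case: n => [|n] /=; ring.
have h1 := h iB n.
have h2 : nm (coup (fun k => -1 * x iU k + y iU k) n) <= 2 * (e / 4).
  apply: (@le_trans _ _ (2 * (e / 4) * (5 / 8) ^+ n)).
    by apply: coup_le => k; rewrite mulN1r addrC.
  by rewrite ler_piMr ?mulr_ge0 ?divr_ge0 ?(ltW e0)// exprn_ile1//; lra.
have h3 : nm (at0 (y iC 0%N - x iC 0%N) n) <= e / 4.
  case: n {h1 h2} => [|n]; first exact: h iC 0%N.
  by rewrite /at0 Normc.normc0 divr_ge0// ltW.
apply: le_trans (nmB _ _) _.
have := nmB (y iB n - x iB n) (coup (fun k => -1 * x iU k + y iU k) n); lra.
Qed.

Definition Hdom : l2dom R 'I_5 :=
  L2Dom coupled_sqs coupled_0 coupled_lin coupled_closed.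

(** The pole c_0/z becomes a constant, absorbed in the nonnegative part, while the new c_0 is 0; the
    other part of the equation is [coup_lam]. *)
Lemma shift5_coupled x : coupled x -> coupled (shift5 lam x).
Proof.
move=> [sx dx bx]; split.
- by move=> c; apply: shift5_sqs => //; exact: lam_le1.
- by move=> n; rewrite /shift5/mk5/= dx mulr0.
- move=> n; rewrite /shift5/mk5/= bx/= coup_lam dx mulr0.
  by case: n.
Qed.

Definition Kop : l2op (@Kdom R) Kdom :=
  L2Op (A := Kdom) (B := Kdom) (shift5_sqs lam_le1) (shift5_lin lam).
Definition Kop' : l2op (@Kdom R) Kdom :=
  L2Op (A := Kdom) (B := Kdom) (cshift5_sqs lam_le1) (cshift5_lin lam).
Definition Hop : l2op Hdom Hdom :=
  L2Op (A := Hdom) (B := Hdom) shift5_coupled (shift5_lin lam).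
Definition incl : l2op Hdom (@Kdom R) :=
  L2Op (A := Hdom) (B := Kdom) coupled_sqs (fun _ _ _ _ _ => erefl).

Notation H := (l2_hilbert (A := Hdom)).
Notation K := (l2_hilbert (A := @Kdom R)).

Definition modelS : {linear H -> H} := l2map Hop.
Definition modelM : {linear K -> K} := l2map Kop.
Definition modelM' : {linear K -> K} := l2map Kop'.
Definition modelJ : {linear H -> K} := l2map incl.

Lemma sqn_le_nrm (A : l2dom R 'I_5) (x : l2 A) c : sqn (x c) <= nrm x ^+ 2.
Proof. by rewrite nrm_sq sqn_nrm2. Qed.

Lemma S_bounded : bounded_op modelS.
Proof.
apply: (@nrm_bounded _ H _ (5%:R * 2)) => x.
rewrite -mulrA -[X in X%:R](card_ord 5); apply: nrm_le.
  by rewrite mulr_ge0 ?nrm_ge0.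
apply: shift5_bound; [exact: lam_le1|exact: l2_sqs|exact: sqn_le_nrm].
Qed.

Lemma M_bounded : bounded_op modelM.
Proof.
apply: (@nrm_bounded _ K _ (5%:R * 2)) => x.
rewrite -mulrA -[X in X%:R](card_ord 5); apply: nrm_le.
  by rewrite mulr_ge0 ?nrm_ge0.
apply: shift5_bound; [exact: lam_le1|exact: l2_sqs|exact: sqn_le_nrm].
Qed.

Lemma M'_bounded : bounded_op modelM'.
Proof.
apply: (@nrm_bounded _ K _ (5%:R * 2)) => x.
rewrite -mulrA -[X in X%:R](card_ord 5); apply: nrm_le.
  by rewrite mulr_ge0 ?nrm_ge0.
apply: cshift5_bound; [exact: lam_le1|exact: l2_sqs|exact: sqn_le_nrm].
Qed.

Lemma S_subnormal : subnormal modelS.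
Proof.
exists K, modelJ, modelM; split => //; last by move=> x; exact: l2_ext.
split; first exact: M_bounded.
exists modelM'; split; first exact: M'_bounded.
  by move=> x y; apply: shift5_adjoint; exact: l2_sqs.
move=> x; apply: l2_ext => c i.
by rewrite -[LHS]/(shift5 lam (cshift5 lam x) c i) -shift5_normal.
Qed.

End Model.

Lemma half_small (R : realType) (e : R) : 0 < e ->
  exists N, forall k, (N <= k)%N -> nm (half ^+ k : R[i]) < e.
Proof.
move=> /invS_small[N hN]; exists N => k Nk; apply: le_lt_trans hN.
apply: le_trans (invS_le R Nk); rewrite nmX nm_half exprVn /invS.
by rewrite lef_pV2 ?posrE ?exprn_gt0 ?ltr0n// -natrX ler_nat ltn_expl.
Qed.

(** * Explicit vectors of H *)

Section Vectors.
Context {R : realType}.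
Notation vec := ('I_5 -> nat -> R[i]).
Context (lam : nat -> R[i]).
Context (lam_half : forall k, nm (lam k - half) < 8^-1).
Notation Hd := (Hdom lam_half).
Notation H := (l2_hilbert (A := Hdom lam_half)).
Notation S := (modelS lam_half).

Lemma sqs_bdd (u : nat -> R[i]) : sqs u -> exists2 m : R, 0 <= m & forall k, nm (u k) <= m.
Proof.
move=> hu; exists (sqn u + 1) => [|k]; first by have := sqn_ge0 hu; lra.
have h := nm_coord_sqn k hu; have := sqr_ge0 (nm (u k) - 1); rewrite sqrrB1.
by have := nm_ge0 (u k); lra.
Qed.

Lemma sqs_coup u : sqs u -> sqs (coup lam u).
Proof.
by move=> /sqs_bdd[m _ hm]; exists (8 * m ^+ 2) => N; exact: (coup_psum lam_half).
Qed.

Lemma sqs_at0 (z : R[i]) : sqs (at0 z).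
Proof. by apply: (@sqs_fin _ _ 1) => -[]. Qed.

(** The components a, u and c are free coordinates on H; the other two are determined by them. *)
Lemma mkH_coupled a u c : sqs a -> sqs u -> sqs c ->
  Hd (mk5 a (fun n => coup lam u n + at0 (c 0%N) n) u c (fun=> 0)).
Proof.
move=> ha hu hc; split => //; apply: ord5_cases => //=; last exact: sqs0.
by apply: sqsD; [exact: sqs_coup | exact: sqs_at0].
Qed.

Definition mkH a u c ha hu hc : l2 Hd := L2 (@mkH_coupled a u c ha hu hc).

Definition dlt (k : nat) : nat -> R[i] := fun i => if i == k then 1 else 0.

Lemma sqs_dlt k : sqs (dlt k).
Proof. by apply: (@sqs_fin _ _ k.+1) => i hi; rewrite /dlt gtn_eqF. Qed.

Lemma sqn_dlt k : sqn (dlt k) <= 1.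
Proof.
rewrite /sqn (@sdot_single _ _ _ k) => [|i ik]; last by rewrite /dlt (negbTE ik).
by rewrite mulCJ /dlt eqxx Normc.normc1 expr1n.
Qed.

Lemma sqn0 : sqn (fun=> 0 : R[i]) = 0.
Proof. by rewrite /sqn sdot0l. Qed.

(** As triples: [eA n] is (z^n, 0, 0), [vU k] is (2^-k / (z - lam k), dlt k, 0), [wC 0] is (1/z, 0,
    1), and [wC n] is (0, 0, z^n) for n > 0. *)
Definition eA n : H := mkH (sqs_dlt n) (@sqs0 R) (@sqs0 R).
Definition vU k : H := mkH (@sqs0 R) (sqs_dlt k) (@sqs0 R).
Definition wC n : H := mkH (@sqs0 R) (@sqs0 R) (sqs_dlt n).

Lemma coup0 n : coup lam (fun=> 0) n = 0.
Proof. by rewrite (@coup_single _ _ _ 0%N)// mulr0. Qed.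

Lemma at00 n : at0 (0 : R[i]) n = 0. Proof. by case: n. Qed.

Lemma coup_dlt k n : coup lam (dlt k) n = half ^+ k * lam k ^+ n.
Proof.
rewrite (@coup_single _ _ _ k) => [|i ik]; last by rewrite /dlt (negbTE ik).
by rewrite /dlt eqxx mulr1.
Qed.

Lemma coordB (x : H) n : x iB n = coup lam (x iU) n + at0 (x iC 0%N) n.
Proof. by case: (l2P x). Qed.

Lemma coordD (x : H) n : x iD n = 0.
Proof. by case: (l2P x). Qed.

Lemma H_ext (x y : H) : (forall i, x iA i = y iA i) -> (forall i, x iU i = y iU i) ->
  (forall i, x iC i = y iC i) -> x = y.
Proof.
move=> ha /funext hu hc; apply: l2_ext; apply: ord5_cases => i.
- exact: ha.
- by rewrite !coordB hu hc.
- by rewrite hu.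
- exact: hc.
- by rewrite !coordD.
Qed.

Lemma SE (x : H) c i : S x c i = shift5 lam x c i. Proof. by []. Qed.

(** On the circle w / (w - lam k) = lam k / (w - lam k) + 1: up to an error of size 2^-k, [vU k] is
    an eigenvector for lam k. *)
Lemma S_vU k z : S (vU k) - z *: vU k = (lam k - z) *: vU k + half ^+ k *: eA 0.
Proof.
apply: H_ext => i; rewrite !l2E_add !l2E_opp !l2E_scale SE /shift5 /= /mk5 /=.
- case: i => [|i]; rewrite /= /mk5 /= ?coup_dlt /at0 /dlt /=; ring.
- by rewrite /dlt; case: eqP => [->|_]; rewrite /=; ring.
- by case: i => [|i] /=; rewrite /mk5 /=; ring.
Qed.

Lemma nrm_vU k : nrm (vU k) <= 15.
Proof.
(* Each of the five components has norm at most 3, the principal part having squared norm at most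
   8. *)
have -> : 15 = #|'I_5|%:R * 3 :> R by rewrite card_ord -natrM.
apply: nrm_le => //.
apply: ord5_cases; rewrite /= /mk5 /= ?sqn0 ?sqr_ge0//.
- apply: sqn_le => N; apply: (@le_trans _ _ (8 * 1 ^+ 2)); last by lra.
  rewrite (eq_bigr (fun n : 'I_N => nm (coup lam (dlt k) n) ^+ 2)); last first.
    by move=> n _; rewrite at00 addr0.
  apply: (coup_psum lam_half) => i; rewrite /dlt; case: eqP => _.
    by rewrite Normc.normc1.
  by rewrite Normc.normc0.
- by apply: le_trans (sqn_dlt k) _; lra.
Qed.

Lemma nrm_eA k : nrm (eA k) <= 5.
Proof.
have -> : 5 = #|'I_5|%:R * 1 :> R by rewrite card_ord mulr1.
apply: nrm_le => //.
apply: ord5_cases; rewrite /= /mk5 /= ?sqn0 ?sqr_ge0//.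
  by rewrite expr1n sqn_dlt.
rewrite (_ : (fun n => _) = (fun=> 0)) ?sqn0 ?sqr_ge0//.
by apply/funext => n; rewrite coup0 at00 addr0.
Qed.

End Vectors.

(** * Spectra *)

Section Essential.
Context {R : realType}.
Context (lam : nat -> R[i]).
Context (lam_half : forall k, nm (lam k - half) < 8^-1).
Notation H := (l2_hilbert (A := Hdom lam_half)).
Notation S := (modelS lam_half).
Context (lam_dense : forall z (e : R), nm (z - half) < 8^-1 -> 0 < e ->
        exists k, 0 < nm (lam k - z) < e).

(* Unit coordinate vectors at nodes tending rapidly to z are approximate
   eigenvectors; the sum of their images converges, but its only possible
   preimage has infinitely many coordinates equal to 1. *)
Lemma essential_disc z : nm (z - half) < 8^-1 -> essential_spectrum S z.
Proof.
move=> zh [_ cl _].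
(* 20 is the sum of the norm bounds 15 and 5 of [vU] and [eA]; the increments of [Y] are then
   dominated by a telescoping series. *)
pose eps j : R := (invS R j - invS R j.+1) / 20.
have eps0 j : 0 < eps j.
  rewrite divr_gt0// subr_gt0 /invS ltf_pV2 ?posrE ?ltr0n// ltr_nat//.
pose P j k := 0 < nm (lam k - z) < eps j /\ nm (half ^+ k : R[i]) < eps j.
have sel (t : nat * nat) : exists k, (t.1 <= k)%N /\ P t.2 k.
  have [N hN] := half_small (eps0 t.2).
  have hd (e : R) : 0 < e -> exists k, 0 < nm (lam k - z) < e by exact: lam_dense.
  have [k hk h] := nodes_tail (maxn N t.1) hd (eps0 t.2).
  move: hk; rewrite geq_max => /andP[h1 h2]; exists k; split => //; split => //.
  exact: hN.
have [g Hg] := choice sel.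
(* The first argument of [g] is a lower bound for the index: the chosen nodes have strictly
   increasing indices. *)
pose fix kk j := if j is i.+1 then g ((kk i).+1, i.+1) else g (0%N, 0%N).
have kP j : P j (kk j) by case: j => [|j]; [exact: (Hg (0%N, 0%N)).2|exact: (Hg ((kk j).+1, j.+1)).2].
have kS j : (kk j < kk j.+1)%N by exact: (Hg ((kk j).+1, j.+1)).1.
have kmono i j : (i < j)%N -> (kk i < kk j)%N.
  elim: j => // j IH; rewrite ltnS leq_eqVlt => /orP[/eqP ->//|/IH h].
  exact: ltn_trans h (kS j).
have kge j : (j <= kk j)%N.
  by elim: j => // j IH; exact: leq_ltn_trans IH (kS j).
have kinj i j : kk i = kk j -> i = j.
  move=> h; case: (ltngtP i j) => // /kmono; by rewrite h ltnn.
pose X n : H := \sum_(j < n) vU lam_half (kk j).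
pose Y n : H := S (X n) - z *: X n.
have YS n : Y n.+1 = Y n + (S (vU lam_half (kk n)) - z *: vU lam_half (kk n)).
  by rewrite /Y /X big_ord_recr/= raddfD scalerDr opprD addrACA.
have YE n : Y n = \sum_(j < n)
    ((lam (kk j) - z) *: vU lam_half (kk j) + half ^+ kk j *: eA lam_half 0).
  elim: n => [|n IH]; first by rewrite /Y /X !big_ord0 raddf0 scaler0 subr0.
  by rewrite YS IH S_vU big_ord_recr.
have step n : nrm (Y n.+1 - Y n) <= invS R n - invS R n.+1.
  rewrite YS addrC addKr S_vU.
  have [/andP[_ h1] h2] := kP n.
  apply: le_trans (nrmD _ _) _; rewrite !nrmZ.
  have := nrm_vU lam_half (kk n); have := nrm_eA lam_half 0.
  have := nm_ge0 (lam (kk n) - z); have := nm_ge0 (half ^+ kk n : R[i]).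
  have -> : invS R n - invS R n.+1 = 20 * eps n.
    by rewrite /eps mulrC divfK// pnatr_eq0.
  nra.
have tele n d : nrm (Y (n + d)%N - Y n) <= invS R n - invS R (n + d)%N.
  elim: d => [|d IH].
    by rewrite addn0 !subrr /nrm normr0.
  have -> : Y (n + d.+1)%N - Y n = (Y (n + d).+1 - Y (n + d)%N) + (Y (n + d)%N - Y n).
    by rewrite addnS addrA subrK.
  apply: le_trans (nrmD _ _) _; rewrite addnS; have := step (n + d)%N; lra.
have cau n m : nrm (Y n - Y m) <= invS R n + invS R m.
  have i0 := invS_gt0 R n; have i1 := invS_gt0 R m.
  have [nm|/ltnW mn] := leqP n m.
    rewrite nrmBC -(subnKC nm); have := tele n (m - n)%N; rewrite subnKC//; lra.
  by rewrite -(subnKC mn); have := tele m (n - m)%N; rewrite subnKC//; lra.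
have [l Hl] := seq_complete cau.
have [x _ xl] : range (fun x : H => S x - z *: x) l.
  have -> : range (fun x : H => S x - z *: x) =
      closure (range (fun x : H => S x - z *: x)) by exact/closure_id.
  apply/closureP => e e0.
  have [n hn] := invS_small (divr_gt0 e0 (ltr0n R 2)).
  exists (Y n); first by exists (X n).
  by rewrite nrmBC; have := Hl n; lra.
have Ycoord j n : (j < n)%N -> Y n iU (kk j) = lam (kk j) - z.
  move=> jn; rewrite YE l2E_sum (bigD1 (Ordinal jn))// big1 ?addr0.
    by rewrite !l2E_add !l2E_scale /= /mk5/= /dlt eqxx; ring.
  move=> i /eqP ij; rewrite !l2E_add !l2E_scale /= /mk5/= /dlt.
  case: eqP => [/kinj h|_]; last by ring.
  by case: ij; apply: val_inj.
have lcoord j : l iU (kk j) = lam (kk j) - z.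
  apply/eqP; rewrite eq_sym -subr_eq0; apply/eqP/small_eq0 => e e0.
  have [n hn] := invS_small (divr_gt0 e0 (ltr0n R 2)).
  pose p := maxn n j.+1.
  rewrite -(Ycoord j p); last by rewrite /p leq_maxr.
  apply: le_trans (nm_coord_nrm (Y p - l) iU (kk j)) _.
  by have := Hl p; have := invS_le R (leq_maxl n j.+1); rewrite -/p; lra.
(* The chosen nodes differ from z, so the factor lam (kk j) - z cancels. *)
have xcoord j : x iU (kk j) = 1.
  have [/andP[h0 _] _] := kP j.
  have nz : lam (kk j) - z != 0.
    by apply: contraTneq h0 => ->; rewrite Normc.normc0 ltxx.
  apply: (mulfI nz); rewrite mulr1 -[RHS]lcoord -xl l2E_add l2E_opp l2E_scale SE.
  by rewrite /shift5 /= /mk5 /=; ring.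
(* Beyond N the squared norm of x is at most 1/2, but the coordinate [kk N], of index at least N, is
   1. *)
have [N /(_ N (leqnn _)) HN] := sqn_tail (l2_sqs x iU) (divr_gt0 ltr01 (ltr0n R 2)).
have tl : sqs (fun i => if (i < N)%N then 0 else x iU i).
  by apply: (sqs_le (c := 1) (l2_sqs x iU)) => i; rewrite mul1r; case: ifP; rewrite ?Normc.normc0 ?nm_ge0.
have := le_trans (nm_coord_sqn (kk N) tl) HN.
rewrite ltnNge kge xcoord Normc.normc1 expr1n; lra.
Qed.

(** An invertible operator has zero kernel and full range, hence is Fredholm. *)
Lemma spectrum_essential z : essential_spectrum S z -> spectrum S z.
Proof.
move=> h [T' [bT K1 K2]]; apply: h.
have rT : range (fun x : H => S x - z *: x) = setT.
  by apply/seteqP; split => // y _; exists (T' y).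
split.
- exists 0%N, (fun=> 0) => x /= hx; exists (fun=> 0).
  by rewrite big_ord0 -(K1 x) hx raddf0.
- rewrite rT; exact: closedT.
- exists 0%N, (fun=> 0) => x; exists x; first by rewrite rT.
  by exists (fun=> 0); rewrite big_ord0 addr0.
Qed.

(** The centre 1/2 separates the two sets: a disc around it lies in the spectrum, and this whole
    disc is essential. *)
Lemma spectral_inequality :
  closure (spectrum S `\` essential_spectrum S) <> closure (interior (spectrum S)).
Proof.
have nE (z : R[i]^o) : nrm z = nm z by rewrite /nrm normE.
move=> E.
have : closure (interior (spectrum S)) (half : R[i]^o).
  apply: subset_closure; apply/nbhs_nrmP; exists 8^-1; first by rewrite invr_gt0.
  move=> y; rewrite nE nmBC => h; apply: spectrum_essential.
  exact: essential_disc.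
rewrite -E => /closureP/(_ 8^-1)[|y [_ hy]]; first by rewrite invr_gt0.
by rewrite nE nmBC => h; apply: hy; exact: essential_disc.
Qed.

End Essential.

(** * S is not cyclic *)

Section NotCyclic.
Context {R : realType}.
Context (lam : nat -> R[i]).
Context (lam_half : forall k, nm (lam k - half) < 8^-1).
Notation H := (l2_hilbert (A := Hdom lam_half)).
Notation S := (modelS lam_half).

Lemma lam_neq0 k : lam k != 0.
Proof.
apply: contraTneq (lam_ge lam_half k) => ->.
by rewrite Normc.normc0 -ltNge divr_gt0.
Qed.

Lemma nm_lamV k : nm (lam k)^-1 <= 3.
Proof.
have h := lam_ge lam_half k; rewrite Normc.normcV invf_ple ?posrE//; lra.
Qed.

(** The opposite of the value at 0 of sum_k 2^-k u_k / (z - lam k). *)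
Definition cinv (u : nat -> R[i]) : R[i] := csum (fun k => half ^+ k * ((lam k)^-1 * u k)).

Lemma cinv_term (u : nat -> R[i]) (m : R) N : (forall k, nm (u k) <= m) ->
  \sum_(k < N) nm (half ^+ k * ((lam k)^-1 * u k)) <= 6 * m.
Proof.
move=> hu; have m0 : 0 <= m by exact: le_trans (nm_ge0 _) (hu 0%N).
apply: (@le_trans _ _ (\sum_(k < N) (2^-1) ^+ k * (3 * m))).
  apply: ler_sum => k _; rewrite !Normc.normcM nmX nm_half.
  rewrite ler_wpM2l ?exprn_ge0 ?invr_ge0// ler_pM ?nm_ge0//.
  exact: nm_lamV.
rewrite -mulr_suml.
have : \sum_(k < N) (2^-1 : R) ^+ k <= 2 by apply: geom_le2.
nra.
Qed.

Lemma cinv_abssum u : sqs u -> abssum (fun k => half ^+ k * ((lam k)^-1 * u k)).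
Proof. by move=> /sqs_bdd[m _ hm]; exists (6 * m) => N; exact: cinv_term. Qed.

Lemma cinv_lin a u v : sqs u -> sqs v ->
  cinv (fun k => a * u k + v k) = a * cinv u + cinv v.
Proof.
move=> hu hv; rewrite /cinv -csumZ -?csumD; try exact: cinv_abssum.
  by congr csum; apply/funext => k; ring.
by apply: abssumZ; exact: cinv_abssum.
Qed.

Lemma cinv_lam u : cinv (fun k => lam k * u k) = coup lam u 0.
Proof.
congr csum; apply/funext => k.
by rewrite mulKf ?lam_neq0// expr0 mulr1.
Qed.

Definition phi1 (x : H) : R[i] := x iC 0%N.
(* Regularized value at 0 of f(z) = sum_n a_n z^n + sum_k 2^-k u_k / (z - lam k)
   + c_0 / z: the term 4 c_1 compensates the pole c_0 / z. *)
Definition phi2 (x : H) : R[i] := x iA 0%N - cinv (x iU) - 4 * x iC 1%N.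

Lemma phi1_S x : phi1 (S x) = 0.
Proof. by rewrite /phi1 SE /shift5 /= /mk5 /= coordD mulr0. Qed.

(** The new constant term is b_0 = [coup lam (x iU) 0] + c_0. The first summand is cancelled by
    [cinv], the second by the next coefficient c_0/4 of g, which explains the factor 4. *)
Lemma phi2_S x : phi2 (S x) = 0.
Proof.
rewrite /phi2 !SE /shift5 /= /mk5 /= coordB cinv_lam /at0.
have -> : 4 * (quarter * x iC 0%N) = x iC 0%N.
  rewrite mulrA (_ : 4 * quarter = 1) ?mul1r// /quarter.
  by rewrite fmorphV rmorph_nat mulfV// pnatr_eq0.
by ring.
Qed.

Lemma phi2_lin a x y : phi2 (a *: x + y) = a * phi2 x + phi2 y.
Proof.
rewrite /phi2.
have -> : cinv ((a *: x + y : H) iU) = a * cinv (x iU) + cinv (y iU).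
  by rewrite -cinv_lin//; exact: l2_sqs.
by rewrite !l2E_add !l2E_scale; ring.
Qed.

Lemma phi2_bound x : nm (phi2 x) <= 11 * nrm x.
Proof.
have h1 : nm (cinv (x iU)) <= 6 * nrm x.
  by apply: nm_csum_le => N; apply: cinv_term => k; exact: nm_coord_nrm.
have h2 := nm_coord_nrm x iA 0; have h3 := nm_coord_nrm x iC 1.
have n4 : nm (4 : R[i]) = 4 by rewrite -[4 : R[i]](rmorph_nat (real_complex R)) nm_real ger0_norm.
rewrite /phi2; apply: le_trans (nmB _ _) _; rewrite Normc.normcM n4.
have := nmB (x iA 0%N) (cinv (x iU)); lra.
Qed.

(** Terms of positive degree lie in the range of S; the constant term is a multiple of G. *)
Lemma poly_op_ker (psi : H -> R[i]) (p : {poly R[i]}) (G : H) :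
  (forall a x y, psi (a *: x + y) = a * psi x + psi y) ->
  (forall x, psi (S x) = 0) -> psi G = 0 -> psi (poly_op S p G) = 0.
Proof.
move=> lin hS hG.
have psi0 : psi 0 = 0 by have := lin (-1) 0 0; rewrite scaler0 addr0 mulN1r addNr.
rewrite /poly_op; elim/big_rec: _ => // k y _ hy.
rewrite lin hy addr0; case: (k : nat) => [|j]; first by rewrite /= hG mulr0.
by rewrite iterS hS mulr0.
Qed.

(** A combination of the two functionals that vanishes at a cyclic vector G would vanish on all of
    H, whereas [eA 0] and [wC 0] show that the functionals are independent. *)
Lemma not_1_cyclic (G : 'I_1 -> H) : P2 S G <> setT.
Proof.
move=> hG.
have key (al be : R[i]) : al * phi1 (G ord0) + be * phi2 (G ord0) = 0 -> al = 0 /\ be = 0.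
  move=> h; pose psi x := al * phi1 x + be * phi2 x.
  have lin a x y : psi (a *: x + y) = a * psi x + psi y.
    rewrite /psi phi2_lin /phi1 l2E_add l2E_scale; ring.
  have bd x : nm (psi x) <= (nm al + 11 * nm be) * nrm x.
    apply: le_trans (nmD _ _) _; rewrite !Normc.normcM mulrDl.
    apply: lerD; first by rewrite ler_wpM2l ?nm_ge0//; exact: nm_coord_nrm.
    by rewrite [11 * _]mulrC -mulrA ler_wpM2l ?nm_ge0// phi2_bound.
  have psi0 x : psi x = 0.
    have : P2 S G x by rewrite hG.
    move=> /closureP hx; apply: small_eq0 => e e0.
    have K0 : 0 < nm al + 11 * nm be + 1.
      by have := nm_ge0 al; have := nm_ge0 be; lra.
    have [_ [p ->] hy] := hx _ (divr_gt0 e0 K0).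
    rewrite big_ord1 in hy.
    have Z : psi (poly_op S (p ord0) (G ord0)) = 0.
      apply: poly_op_ker => //; rewrite /psi => y.
      by rewrite phi1_S phi2_S !mulr0 addr0.
    have -> : psi x = psi (x - poly_op S (p ord0) (G ord0)).
      by have := lin (-1) (poly_op S (p ord0) (G ord0)) x; rewrite Z mulr0 add0r scaleN1r addrC.
    apply: le_trans (bd _) _; move: hy; rewrite ltr_pdivlMr//.
    have := nrm_ge0 (x - poly_op S (p ord0) (G ord0)); lra.
  have zC : phi1 (eA lam_half 0) = 0 by [].
  have cinv0 : cinv (fun=> 0) = 0.
    by rewrite /cinv -[RHS](@csum0 R); congr csum; apply/funext => k; rewrite !mulr0.
  have h1 : phi2 (eA lam_half 0) = 1.
    by rewrite /phi2 /= /mk5 /= cinv0 /dlt eqxx mulr0 !subr0.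
  have h2 : phi1 (wC lam_half 0) = 1 by rewrite /phi1 /= /mk5 /= /dlt eqxx.
  have := psi0 (eA lam_half 0); rewrite /psi zC h1 mulr0 add0r mulr1 => be0.
  by have := psi0 (wC lam_half 0); rewrite /psi h2 be0 mul0r addr0 mulr1.
(* This relation holds for every G and forces [phi1] to vanish at G; then (1, 0) is a nontrivial
   relation. *)
have [|h1 h2] := key (phi2 (G ord0)) (- phi1 (G ord0)); first by ring.
have [|/eqP] := key 1 0; last by rewrite oner_eq0.
by move/eqP: h2; rewrite oppr_eq0 => /eqP ->; rewrite mulr0 mul0r addr0.
Qed.

End NotCyclic.

(** * Irreducibility *)

Section DominatedSums.
Context {R : realType}.

Lemma csum_split (x : nat -> R[i]) K : abssum x ->
  csum x = \sum_(i < K) x i + csum (fun i => x (K + i)%N).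
Proof.
elim: K x => [|K IH] x hx; first by rewrite big_ord0 add0r.
rewrite csumS// IH; last exact: abssumS.
by rewrite big_ord_recl addrA.
Qed.

Lemma abssum_tail (x : nat -> R[i]) (e : R) : abssum x -> 0 < e ->
  exists K, forall N, \sum_(i < N) nm (x (K + i)%N) <= e.
Proof.
move=> [M HM] e0; have [|l Hl] := @real_series_conv R (fun i => nm (x i)) M.
  by move=> n; under eq_bigr do rewrite ger0_norm ?nm_ge0//; exact: HM.
have [K HK] := Hl _ (divr_gt0 e0 (ltr0n R 2)); exists K => N.
have := HK K (leqnn _); have := HK (K + N)%N (leq_addr _ _).
rewrite big_split_ord /= !ltr_norml => /andP[h1 h2] /andP[h3 h4].
lra.
Qed.

Lemma expr_small (q e : R) : 0 <= q -> q < 1 -> 0 < e ->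
  exists N, forall n, (N <= n)%N -> q ^+ n < e.
Proof.
move=> q0 q1 e0.
have /cvgrPdist_lt/(_ e e0)[N _ HN] : q ^+ n @[n --> \oo] --> (0 : R).
  by apply: cvg_expr; rewrite ger0_norm.
exists N => n /HN /=; rewrite sub0r normrN ger0_norm// exprn_ge0//.
Qed.

Lemma fin_sum_small (q c : nat -> R) K (e : R) :
  (forall k, 0 <= q k < 1) -> (forall k, 0 <= c k) -> 0 < e ->
  exists N, forall n, (N <= n)%N -> \sum_(k < K) q k ^+ n * c k <= e.
Proof.
move=> hq hc; elim: K e => [|K IH] e e0.
  by exists 0%N => n _; rewrite big_ord0 ltW.
have e2 : 0 < e / 2 by rewrite divr_gt0.
have [N HN] := IH _ e2.
have c1 : 0 < c K + 1 by have := hc K; lra.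
have /andP[q0 q1] := hq K.
have [N' HN'] := expr_small q0 q1 (divr_gt0 e2 c1).
exists (maxn N N') => n; rewrite geq_max => /andP[/HN h1 /HN' h2].
rewrite big_ord_recr/=.
have : q K ^+ n * c K <= e / 2.
  move: h2; rewrite ltr_pdivlMr// => h2; apply: le_trans (ltW h2).
  by rewrite ler_wpM2l ?exprn_ge0//; lra.
lra.
Qed.

(** The tail of x is small uniformly in n because the weights are at most 1; the finitely many
    remaining terms tend to 0 with q k ^ n. *)
Lemma dominated_csum (w : nat -> nat -> R[i]) (q : nat -> R) (x : nat -> R[i]) (e : R) :
  abssum x -> (forall k, 0 <= q k < 1) -> (forall n k, nm (w n k) <= q k ^+ n) ->
  0 < e -> exists n, nm (csum (fun k => w n k * x k)) <= e.
Proof.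
move=> hx hq hw e0; have e2 : 0 < e / 2 by rewrite divr_gt0.
have w1 n k : nm (w n k * x k) <= nm (x k).
  rewrite Normc.normcM ler_piMl ?nm_ge0//; apply: le_trans (hw n k) _.
  by have /andP[q0 q1] := hq k; rewrite exprn_ile1// ltW.
have hs n : abssum (fun k => w n k * x k) by apply: abssum_le hx _.
have [K HK] := abssum_tail hx e2.
have [N HN] := @fin_sum_small q (fun k => nm (x k)) K _ hq (fun k => nm_ge0 (x k)) e2.
exists N; rewrite (csum_split K (hs N)); apply: le_trans (nmD _ _) _.
have h1 : nm (csum (fun i => w N (K + i)%N * x (K + i)%N)) <= e / 2.
  apply: nm_csum_le => n; apply: le_trans (HK n); apply: ler_sum => i _; exact: w1.
have h2 : nm (\sum_(i < K) w N i * x i) <= e / 2.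
  apply: le_trans (nm_sum _ _ _) _; apply: le_trans (HN N (leqnn _)).
  by apply: ler_sum => i _; rewrite Normc.normcM ler_wpM2r ?nm_ge0.
lra.
Qed.

End DominatedSums.

(** * Orthogonal invariant pairs and reducing subspaces *)

Section Irreducible.
Context {R : realType}.
Context (lam : nat -> R[i]).
Context (lam_half : forall k, nm (lam k - half) < 8^-1).
Notation H := (l2_hilbert (A := Hdom lam_half)).
Notation S := (modelS lam_half).
Context (lam_inj : injective lam).

Lemma sdot0r (x : nat -> R[i]) : sdot x (fun=> 0) = 0.
Proof.
rewrite /sdot -[RHS](@csum0 R); congr csum; apply/funext => i.
by rewrite rmorph0 mulr0.
Qed.

Lemma sdot_dltr (x : nat -> R[i]) k : sdot x (dlt k) = x k.
Proof.
rewrite /sdot (@csum_single _ _ k) => [|i ik].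
  by rewrite /dlt eqxx rmorph1 mulr1.
by rewrite /dlt (negbTE ik) rmorph0 mulr0.
Qed.

Lemma innerE (x y : H) : inner H x y =
  sdot (x iA) (y iA) + sdot (x iB) (y iB) + sdot (x iU) (y iU) + sdot (x iC) (y iC).
Proof.
have -> : inner H x y = \sum_(c : 'I_5) sdot (x c) (y c) by [].
rewrite sum_ord5 (_ : x iD = fun=> 0) ?sdot0l ?addr0//.
by apply/funext => i; exact: coordD.
Qed.

Lemma inner_eA (x : H) n : inner H x (eA lam_half n) = x iA n.
Proof.
rewrite innerE /= /mk5 /= sdot_dltr !sdot0r !addr0 (_ : (fun n => _) = fun=> 0).
  by rewrite sdot0r addr0.
by apply/funext => i; rewrite coup0 at00 addr0.
Qed.

Lemma S_eA n : S (eA lam_half n) = eA lam_half n.+1.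
Proof.
apply: H_ext => i; rewrite SE /shift5 /= /mk5 /=.
- by case: i => [|i] /=; rewrite ?coup0 ?at00 ?addr0.
- by rewrite mulr0.
- by case: i => [|i]; rewrite /= ?mulr0.
Qed.

Lemma S_wC n : S (wC lam_half n) =
  quarter *: wC lam_half n.+1 + at0 1 n *: eA lam_half 0.
Proof.
apply: H_ext => i; rewrite l2E_add !l2E_scale SE /shift5 /= /mk5 /=.
- by case: i => [|i]; case: n => [|n]; rewrite /= ?coup0 /dlt /=; ring.
- by ring.
- by case: i => [|i]; rewrite /= /dlt ?eqSS; ring.
Qed.

Definition q2 : R[i] := quarter * quarter.

Lemma inner_SS (x y : H) : inner H (S x) (S y) =
  sdot (x iA) (y iA) + sdot (x iB) (y iB)
  + csum (fun k => (lam k * (lam k)^*) * (x iU k * (y iU k)^*))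
  + q2 * sdot (x iC) (y iC).
Proof.
rewrite innerE /= /shift5 /mk5 /=; congr (_ + _ + _).
- rewrite sdot_scons; try exact: l2_sqs.
  by rewrite [in RHS](sdotS (l2_sqs x iB) (l2_sqs y iB)); ring.
- by congr csum; apply/funext => k; rewrite rmorphM; ring.
rewrite !coordD /q2.
have sC (z : H) : sqs (scons 0 (z iC)) by apply: sqs_scons; exact: l2_sqs.
have <- : sdot (scons 0 (x iC)) (scons 0 (y iC)) = sdot (x iC) (y iC).
  by rewrite sdot_scons ?mul0r ?add0r//; exact: l2_sqs.
rewrite -csumZ; last exact: abssum_dot.
by congr csum; apply/funext => k; rewrite rmorphM/= conj_quarter; ring.
Qed.

Section Pair.
(** The hypotheses are arranged for a pair, since the conclusions are applied both to L with its
    complement and with the two exchanged. *)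
Context (L L' : set H).
Context (hL : closed_subspace L).
Context (hL' : closed_subspace L').
Context (iL : Defs.invariant S L).
Context (iL' : Defs.invariant S L').
Context (orth : forall x y, L x -> L' y -> inner H x y = 0).
Context (dec : forall z, exists2 x, L x & L' (z - x)).

Definition nod2 k : R[i] := lam k * (lam k)^*.
Definition wt k : R[i] := (1 - nod2 k) * (nod2 k - q2).

Lemma nm_nod2 k : nm (nod2 k) = nm (lam k) ^+ 2.
Proof. by rewrite Normc.normcM nmJ expr2. Qed.

Lemma nm_nod2_le1 k : nm (nod2 k) <= 1.
Proof. by rewrite nm_nod2 exprn_ile1 ?nm_ge0// lam_le1. Qed.

Lemma wabssum (w : nat -> R[i]) (M : R) (x y : H) : (forall k, nm (w k) <= M) ->
  abssum (fun k => w k * (x iU k * (y iU k)^*)).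
Proof.
move=> hw; have h := abssumZ (M%:C) (abssum_dot (l2_sqs x iU) (l2_sqs y iU)).
apply: abssum_le h _ => k /=; rewrite !(Normc.normcM _ (_ * _)) ler_wpM2r ?nm_ge0//.
by rewrite nm_real (le_trans (hw k))// ler_norm.
Qed.

Lemma nm_q2 : nm q2 = 16^-1.
Proof. by rewrite /q2 Normc.normcM nm_quarter; lra. Qed.

(** The moduli of the nodes lie in [3/8, 5/8], away from the radii 1/4 and 1. *)
Lemma wt_neq0 k : wt k != 0.
Proof.
have l1 := lam_le lam_half k; have l2 := lam_ge lam_half k.
rewrite mulf_neq0// subr_eq0.
  apply/eqP => h; have := nm_nod2 k; rewrite -h Normc.normc1 => h1.
  by have : nm (lam k) ^+ 2 < 1; [nra | rewrite -h1 ltxx].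
apply/eqP => h; have := nm_nod2 k; rewrite h nm_q2 => h1.
by have : 16^-1 < nm (lam k) ^+ 2; [nra | rewrite -h1 ltxx].
Qed.

Lemma nm_wt_le1 k : nm (wt k) <= 1.
Proof.
have l1 := lam_le lam_half k; have l2 := lam_ge lam_half k.
have e : nod2 k = (nm (lam k) ^+ 2)%:C by exact: mulCJ.
have e1 : 1 - nod2 k = (1 - nm (lam k) ^+ 2)%:C by rewrite e rmorphB rmorph1.
have eq : q2 = (16^-1)%:C by rewrite /q2 /quarter -rmorphM; congr (_%:C); lra.
have e2 : nod2 k - q2 = (nm (lam k) ^+ 2 - 16^-1)%:C by rewrite e eq rmorphB.
rewrite /wt e1 e2 -rmorphM.
have v1 : nm (lam k) ^+ 2 <= 25 / 64 by nra.
have v2 : 9 / 64 <= nm (lam k) ^+ 2 by nra.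
by move: (nm (lam k) ^+ 2) v1 v2 => v v1 v2; rewrite nm_real ler_norml; apply/andP; split; nra.
Qed.

(* The weight kills both shift components: |z|^2 is 1 on the first circle and
   1/16 on the second one. *)
Lemma weighted0 x y : L x -> L' y -> csum (fun k => wt k * (x iU k * (y iU k)^*)) = 0.
Proof.
move=> Lx Ly.
have E0 := orth Lx Ly; have E1 := orth (iL Lx) (iL' Ly).
have E2 := orth (iL (iL Lx)) (iL' (iL' Ly)).
rewrite innerE in E0; rewrite inner_SS in E1; rewrite inner_SS in E2.
have EA : sdot (S x iA) (S y iA) + sdot (S x iB) (S y iB) =
    sdot (x iA) (y iA) + sdot (x iB) (y iB).
  rewrite /= /shift5 /mk5 /= sdot_scons; try exact: l2_sqs.
  by rewrite [in RHS](sdotS (l2_sqs x iB) (l2_sqs y iB)); ring.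
have EC : sdot (S x iC) (S y iC) = q2 * sdot (x iC) (y iC).
  rewrite /= /shift5 /mk5 /= !coordD /q2.
  have sC (z : H) : sqs (scons 0 (z iC)) by apply: sqs_scons; exact: l2_sqs.
  have <- : sdot (scons 0 (x iC)) (scons 0 (y iC)) = sdot (x iC) (y iC).
    by rewrite sdot_scons ?mul0r ?add0r//; exact: l2_sqs.
  rewrite -csumZ; last exact: abssum_dot.
  by congr csum; apply/funext => k; rewrite rmorphM/= conj_quarter; ring.
rewrite EA EC in E2.
have EU : csum (fun k => nod2 k * (S x iU k * (S y iU k)^*)) =
    csum (fun k => nod2 k ^+ 2 * (x iU k * (y iU k)^*)).
  congr csum; apply/funext => k; rewrite /= /shift5 /mk5 /= rmorphM /nod2.
  by ring.
rewrite EU in E2.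
set a := sdot (x iA) (y iA) + sdot (x iB) (y iB) in E0 E1 E2.
set c := sdot (x iC) (y iC) in E0 E1 E2.
set u0 := sdot (x iU) (y iU) in E0.
set u1 := csum _ in E1; set u2 := csum _ in E2.
(* The expansion (1 - s)(s - q2) = - s^2 + (1 + q2) s - q2, with s = |lam k|^2. *)
have -> : csum (fun k => wt k * (x iU k * (y iU k)^*)) =
    - 1 * u2 + ((1 + q2) * u1 + (- q2) * u0).
  have h0 := abssum_dot (l2_sqs x iU) (l2_sqs y iU).
  have h1 := wabssum x y nm_nod2_le1.
  have h2 : abssum (fun k => nod2 k ^+ 2 * (x iU k * (y iU k)^*)).
    by apply: (wabssum x y (M := 1)) => k; rewrite nmX exprn_ile1 ?nm_ge0 ?nm_nod2_le1.
  rewrite /u0 /u1 /u2 /sdot -(csumZ (-1) h2) -(csumZ (1 + q2) h1) -(csumZ (- q2) h0).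
  have h3 := abssumD (abssumZ (1 + q2) h1) (abssumZ (- q2) h0).
  rewrite -(csumD (abssumZ (1 + q2) h1) (abssumZ (- q2) h0)) -(csumD (abssumZ (-1) h2) h3).
  by congr csum; apply/funext => k; rewrite /wt -/(nod2 k); ring.
have -> : u0 = - (a + c) by apply/eqP; rewrite -addr_eq0 -E0; apply/eqP; ring.
have -> : u1 = - (a + q2 * c) by apply/eqP; rewrite -addr_eq0 -E1; apply/eqP; ring.
have -> : u2 = - (a + q2 * (q2 * c)) by apply/eqP; rewrite -addr_eq0 -E2; apply/eqP; ring.
by ring.
Qed.

(* On the nodes 1 - dist2 k is 1 at k0 and smaller than 1 in modulus elsewhere:
   its powers isolate the term k0 of the orthogonality relation weighted0. *)
Section Peak.
Context (k0 : nat).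

Definition dist2 k : R[i] := (lam k - lam k0) * (lam k - lam k0)^*.

(** Distinct nodes are at positive distance, at most 1/4 in a disc of radius 1/8. *)
Lemma peak_bound k : k != k0 -> 0 <= nm (1 - dist2 k) < 1.
Proof.
move=> kk; rewrite nm_ge0 /dist2 mulCJ -(rmorph1 (real_complex R)) -rmorphB nm_real.
have d1 : nm (lam k - lam k0) <= 4^-1.
  have -> : lam k - lam k0 = (lam k - half) - (lam k0 - half) by ring.
  by apply: le_trans (nmB _ _) _; have := lam_half k; have := lam_half k0; lra.
have d0 : 0 < nm (lam k - lam k0).
  rewrite lt_def nm_ge0 andbT; apply: contra_neq kk => /Normc.eq0_normc/eqP.
  by rewrite subr_eq0 => /eqP/lam_inj.
rewrite ger0_norm; nra.
Qed.

Lemma peak_le1 k : nm (1 - dist2 k) <= 1.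
Proof.
have [->|/peak_bound/andP[_ /ltW//]] := eqVneq k k0.
by rewrite /dist2 subrr mul0r subr0 Normc.normc1.
Qed.

(** Replacing x and y by their images under S - lam k0 stays in the pair and multiplies the k-th
    term by [dist2 k]; subtracting this relation from the original one yields one more factor 1 -
    [dist2 k]. *)
Lemma weighted_peak n x y : L x -> L' y ->
  csum (fun k => (wt k * (1 - dist2 k) ^+ n) * (x iU k * (y iU k)^*)) = 0.
Proof.
elim: n x y => [|n IH] x y Lx Ly.
  rewrite -[RHS](weighted0 Lx Ly); congr csum; apply/funext => k.
  by rewrite expr0 mulr1.
have Lx' : L (S x - lam k0 *: x).
  by apply: subspace_B => //; [exact: iL | exact: subspace_Z].
have Ly' : L' (S y - lam k0 *: y).
  by apply: subspace_B => //; [exact: iL' | exact: subspace_Z].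
have w1 k : nm (wt k * (1 - dist2 k) ^+ n) <= 1.
  rewrite Normc.normcM nmX -[leRHS]mulr1 ler_pM ?nm_ge0 ?exprn_ge0 ?nm_ge0 ?nm_wt_le1//.
  by rewrite exprn_ile1 ?nm_ge0 ?peak_le1.
have <- : csum (fun k => wt k * (1 - dist2 k) ^+ n * (x iU k * (y iU k)^*)) +
  (-1) * csum (fun k => wt k * (1 - dist2 k) ^+ n *
     ((S x - lam k0 *: x) iU k * ((S y - lam k0 *: y) iU k)^*)) = 0.
  by rewrite IH// IH// mulr0 addr0.
rewrite -csumZ; last exact: wabssum w1.
rewrite -csumD; [|exact: wabssum w1|by apply: abssumZ; exact: wabssum w1].
congr csum; apply/funext => k.
rewrite !l2E_add !l2E_opp !l2E_scale /= /shift5 /mk5 /= -!mulrBl rmorphM /= -/(dist2 k) exprSr.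
have -> : dist2 k = (lam k - lam k0) * (lam k - lam k0)^* by [].
by ring.
Qed.

(** As n grows, the term k0 of [weighted_peak] stays constant while the sum of the others tends to
    0. *)
Lemma orth_coordU x y : L x -> L' y -> x iU k0 * (y iU k0)^* = 0.
Proof.
move=> Lx Ly; apply: (mulfI (wt_neq0 k0)); rewrite mulr0.
apply: small_eq0 => e e0.
(* The index k0 is removed from the dominated sum, because 1 - [dist2 k0] = 1 violates the strict
   bound. *)
pose b k := if k == k0 then 0 else wt k * (x iU k * (y iU k)^*).
pose q k := if k == k0 then 0 else nm (1 - dist2 k).
pose w n k := if k == k0 then 0 else (1 - dist2 k) ^+ n.
have hb : abssum b.
  apply: abssum_le (wabssum x y nm_wt_le1) _ => k; rewrite /b; case: ifP => // _.
  by rewrite Normc.normc0 nm_ge0.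
have [|||n hn] := @dominated_csum R w q b e hb.
- by move=> k; rewrite /q; case: ifPn => [_|/peak_bound//]; rewrite lexx ltr01.
- move=> n k; rewrite /w /q; case: ifP => _; last by rewrite nmX.
  by rewrite Normc.normc0 exprn_ge0.
- by [].
apply: le_trans hn; rewrite -nmN le_eqVlt; apply/orP; left; apply/eqP; congr nm.
apply/eqP; rewrite eq_sym -addr_eq0 addrC; apply/eqP.
rewrite -[RHS](weighted_peak n Lx Ly).
have -> : wt k0 * (x iU k0 * (y iU k0)^*) =
    csum (fun k => if k == k0 then wt k0 * (x iU k0 * (y iU k0)^*) else 0).
  by rewrite (@csum_single _ _ k0) ?eqxx// => i /negbTE ->.
rewrite -csumD; last first.
- apply: abssum_le hb _ => k; rewrite Normc.normcM ler_piMl ?nm_ge0// /w.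
  by case: ifP => _; rewrite ?Normc.normc0// nmX exprn_ile1 ?nm_ge0 ?peak_le1.
- by apply: (@abssum_fin _ _ k0.+1) => i hi; rewrite gtn_eqF.
congr csum; apply/funext => k; rewrite /w /b; case: eqP => [->|_].
  have -> : dist2 k0 = 0 by rewrite /dist2 subrr mul0r.
  by rewrite subr0 expr1n; ring.
by ring.
Qed.

End Peak.

(** Once the l^2 terms vanish, subtracting the orthogonality of S x and S y from that of x and y
    leaves (1 - 1/16) times this product. *)
Lemma orth_C x y : L x -> L' y -> sdot (x iC) (y iC) = 0.
Proof.
move=> Lx Ly.
have E0 := orth Lx Ly; have E1 := orth (iL Lx) (iL' Ly).
rewrite innerE in E0; rewrite inner_SS in E1.
have U0 : sdot (x iU) (y iU) = 0.
  by rewrite /sdot -[RHS](@csum0 R); congr csum; apply/funext => k; exact: orth_coordU.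
have U1 : csum (fun k => lam k * (lam k)^* * (x iU k * (y iU k)^*)) = 0.
  rewrite -[RHS](@csum0 R); congr csum; apply/funext => k.
  by rewrite orth_coordU// mulr0.
rewrite U0 addr0 in E0; rewrite U1 addr0 in E1.
have nz : 1 - q2 != 0.
  have q1 : nm q2 < 1 by rewrite nm_q2; lra.
  by rewrite subr_eq0 eq_sym; apply: contraTneq q1 => ->; rewrite Normc.normc1 ltxx.
apply: (mulfI nz); rewrite mulr0.
have -> : (1 - q2) * sdot (x iC) (y iC) =
    (sdot (x iA) (y iA) + sdot (x iB) (y iB) + sdot (x iC) (y iC)) -
    (sdot (x iA) (y iA) + sdot (x iB) (y iB) + q2 * sdot (x iC) (y iC)) by ring.
by rewrite E0 E1 subrr.
Qed.

(** Used when a vector with a zero coordinate is decomposed along L and L': both parts inherit the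
    zero. *)
Lemma sum_orth0 (a b : R[i]) : a + b = 0 -> a * b^* = 0 -> a = 0 /\ b = 0.
Proof.
move=> /eqP; rewrite addr_eq0 => /eqP ->; rewrite mulNr mulCJ => /eqP.
rewrite oppr_eq0 -(rmorph0 (real_complex R)) (inj_eq (fmorph_inj _)) sqrf_eq0.
by move=> /eqP/Normc.eq0_normc ->; rewrite oppr0.
Qed.

Lemma sum_orthC (x y : H) : (forall i, x iC i + y iC i = 0) ->
  sdot (x iC) (y iC) = 0 -> (forall i, x iC i = 0) /\ forall i, y iC i = 0.
Proof.
move=> h e; have {}h i : x iC i = - y iC i by apply/eqP; rewrite -addr_eq0 h.
suff y0 : forall i, y iC i = 0 by split => // i; rewrite h y0 oppr0.
suff E : y iC = fun=> 0 by move=> i; rewrite E.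
apply: sqn_eq0; first exact: l2_sqs.
suff : sdot (y iC) (y iC) = 0 by rewrite /sqn => ->.
rewrite -[LHS]opprK -[RHS]oppr0; congr (- _); rewrite -[RHS]e -mulN1r.
rewrite -sdotZl; try exact: l2_sqs.
by congr (sdot _ _); apply/funext => i; rewrite h mulN1r.
Qed.

Lemma iterL x n : L x -> L (iter n S x).
Proof. by move=> Lx; elim: n => // n IH; exact: iL. Qed.
Lemma iterL' x n : L' x -> L' (iter n S x).
Proof. by move=> Lx; elim: n => // n IH; exact: iL'. Qed.

Lemma iter_eA n : iter n S (eA lam_half 0) = eA lam_half n.
Proof. by elim: n => // n IH; rewrite iterS IH S_eA. Qed.

Lemma iterB n (x y : H) : iter n S (x - y) = iter n S x - iter n S y.
Proof. by elim: n => // n IH; rewrite !iterS IH raddfB. Qed.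

(** The L-part x of (1, 0, 0) has the form (f, 0, 0) with f in H^2. For m > 0 the product of S^m x
    with x equals that with (1, 0, 0), which is the constant term of z^m f, hence 0; by symmetry it
    also determines the m-th coefficient of f. So x is a multiple of (1, 0, 0). *)
Lemma eA0_dichotomy : L (eA lam_half 0) \/ L' (eA lam_half 0).
Proof.
set e0 := eA lam_half 0; have [x Lx L'y] := dec e0; set y := e0 - x in L'y.
have xU i : x iU i = 0.
  have s : x iU i + y iU i = 0 by rewrite /y /= /mk5 /=; ring.
  exact: (sum_orth0 s (orth_coordU i Lx L'y)).1.
have xC i : x iC i = 0.
  have s j : x iC j + y iC j = 0 by rewrite /y /= /mk5 /=; ring.
  exact: (sum_orthC s (orth_C Lx L'y)).1.
have xB i : x iB i = 0.
  rewrite coordB xC at00 addr0 (_ : x iU = fun=> 0) ?coup0//.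
  exact/funext.
have itB m i : iter m S x iB i = 0.
  elim: m i => [|m IH] i; first exact: xB.
  by rewrite iterS SE /shift5 /= /mk5 /= IH.
have itA m : iter m.+1 S x iA 0%N = 0.
  by rewrite iterS SE /shift5 /= /mk5 /= itB.
have o1 m : inner H (iter m S x) e0 = inner H (iter m S x) x.
  have := orth (iterL m Lx) L'y; rewrite innerBr => /eqP; rewrite subr_eq0.
  by move=> /eqP.
have o2 m : inner H x (eA lam_half m) = inner H x (iter m S x).
  have := orth Lx (iterL' m L'y); rewrite iterB iter_eA innerBr => /eqP.
  by rewrite subr_eq0 => /eqP.
have xA m : x iA m.+1 = 0.
  by rewrite -(inner_eA x) o2 innerC -o1 inner_eA itA rmorph0.
have xE : x = x iA 0%N *: e0.
  apply: H_ext => i; rewrite l2E_scale /= /mk5 /=.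
  - by case: i => [|i]; rewrite /dlt /= ?mulr1 ?mulr0.
  - by rewrite xU mulr0.
  - by rewrite xC mulr0.
(* The factor equals its squared modulus, hence is 0 or 1. *)
have : x iA 0%N = x iA 0%N * (x iA 0%N)^*.
  have h0 : x iA 0%N = inner H x x by rewrite -(inner_eA x) (o2 0%N).
  have h1 : inner H x x = inner H x (x iA 0%N *: e0) by rewrite -xE.
  by rewrite {1}h0 h1 innerZr inner_eA mulrC.
have [a0 _|a0] := eqVneq (x iA 0%N) 0.
  by right; move: L'y; rewrite /y xE a0 scale0r subr0.
rewrite -{1}[x iA 0%N]mulr1 => /(mulfI a0) a1.
left; have : L x by []; rewrite xE (_ : x iA 0%N = 1) ?scale1r//.
by rewrite -[x iA 0%N]conjCK -a1 rmorph1.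
Qed.

Lemma eA0_full : L (eA lam_half 0) -> L = setT.
Proof.
move=> Le.
have LeA n : L (eA lam_half n) by rewrite -iter_eA; exact: iterL.
have yA y n : L' y -> y iA n = 0.
  by move=> L'y; rewrite -(inner_eA y); apply: inner_sym0; exact: orth.
(* The coefficient b_n becomes the constant term of S^(n+1) y, again in L'. *)
have yB y n : L' y -> y iB n = 0.
  move=> L'y; have h m : iter m S y iB 0%N = y iB m.
    have gen m' i : iter m' S y iB i = y iB (m' + i)%N.
      elim: m' i => [|m' IH] i //; rewrite iterS SE /shift5 /= /mk5 /= IH.
      by rewrite addnS.
    by rewrite gen addn0.
  rewrite -h; have := yA (iter n.+1 S y) 0%N (iterL' n.+1 L'y).
  by rewrite iterS SE /shift5 /= /mk5 /=.
have pos k : half ^+ k != 0 :> R[i].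
  rewrite expf_eq0 negb_and; apply/orP; right.
  by apply: contraTneq (_ : 0 < nm (half : R[i])) => [->|];
    rewrite ?Normc.normc0 ?ltxx// nm_half invr_gt0.
have yUC y : L' y -> coup lam (y iU) 0 + y iC 0%N = 0.
  by move=> L'y; have := yB y 0%N L'y; rewrite coordB.
have zero (y : H) : L' y -> (forall i, y iU i = 0) -> (forall i, y iC i = 0) -> y = 0.
  by move=> L'y hU hC; apply: H_ext => i; [exact: yA|exact: hU|exact: hC].
(* The L'-part has c = 0 and u supported at k; the vanishing of b_0 then reads 2^-k u_k = 0. *)
have LvU k : L (vU lam_half k).
  have [x Lx L'y] := dec (vU lam_half k); set y := _ - x in L'y.
  have sC j : x iC j + y iC j = 0 by rewrite /y /= /mk5 /=; ring.
  have [_ yC] := sum_orthC sC (orth_C Lx L'y).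
  have yU i : i != k -> y iU i = 0.
    move=> ik; have s : x iU i + y iU i = 0.
      by rewrite /y /= /mk5 /= /dlt (negbTE ik); ring.
    exact: (sum_orth0 s (orth_coordU i Lx L'y)).2.
  have yUk : y iU k = 0.
    have := yUC y L'y; rewrite yC addr0 (coup_single lam 0 yU) expr0 mulr1.
    by move=> /eqP; rewrite mulf_eq0 (negbTE (pos k)) /= => /eqP.
  have y0 : y = 0.
    by apply: zero => // i; have [->|/yU] := eqVneq i k.
  by move: Lx; rewrite -[x](subKr (vU lam_half k)) -/y y0 subr0.
(* For n = 0 the L'-part has u = 0, so b_0 = 0 gives c_0 = 0; orthogonality of c to dlt 0 - c then
   gives c = 0. The other cases follow by applying S. *)
have LwC n : L (wC lam_half n).
  elim: n => [|n IH].
    have [x Lx L'y] := dec (wC lam_half 0); set y := _ - x in L'y.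
    have yU i : y iU i = 0.
      have s : x iU i + y iU i = 0 by rewrite /y /= /mk5 /=; ring.
      exact: (sum_orth0 s (orth_coordU i Lx L'y)).2.
    have yC0 : y iC 0%N = 0.
      have := yUC y L'y; rewrite (_ : y iU = fun=> 0) ?coup0 ?add0r//.
      exact/funext.
    have yC : sdot (y iC) (y iC) = 0.
      have := orth_C Lx L'y.
      have -> : x iC = (fun i => dlt 0 i + -1 * y iC i).
        by apply/funext => i; rewrite /y /= /mk5 /=; ring.
      rewrite sdotDl ?sdotZl; try exact: l2_sqs; try exact: sqs_dlt; last first.
        by apply: sqsZ; exact: l2_sqs.
      rewrite sdotC; [|exact: sqs_dlt|exact: l2_sqs].
      by rewrite sdot_dltr yC0 rmorph0 add0r mulN1r => /eqP; rewrite oppr_eq0 => /eqP.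
    have y0 : y = 0.
      apply: zero => //; suff E : y iC = fun=> 0 by move=> i; rewrite E.
      by apply: sqn_eq0; [exact: l2_sqs | rewrite /sqn yC].
    by move: Lx; rewrite -[x](subKr (wC lam_half 0)) -/y y0 subr0.
  have q0 : quarter != 0 :> R[i].
    apply: contraTneq (_ : 0 < nm (quarter : R[i])) => [->|];
      by rewrite ?Normc.normc0 ?ltxx// nm_quarter invr_gt0.
  have -> : wC lam_half n.+1 = quarter^-1 *: (S (wC lam_half n) - at0 1 n *: eA lam_half 0).
    by rewrite S_wC addrK scalerA mulVf// scale1r.
  apply: subspace_Z => //; apply: subspace_B => //; first exact: iL.
  exact: subspace_Z.
apply/seteqP; split => // z _.
have [x Lx L'y] := dec z; set y := z - x in L'y.
have yB0 : y iB = fun=> 0 by apply/funext => i; exact: yB.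
have yC0 n : y iC n = 0.
  have := orth (LwC n) L'y; move/inner_sym0; rewrite innerE yB0 sdot0l addr0 /= /mk5 /=.
  by rewrite !sdot0r sdot_dltr !add0r.
have yU0 n : y iU n = 0.
  have := orth (LvU n) L'y; move/inner_sym0; rewrite innerE yB0 sdot0l addr0 /= /mk5 /=.
  by rewrite !sdot0r sdot_dltr add0r addr0.
have y0 : y = 0 by exact: zero.
by rewrite -[z](subrK x) -/y y0 add0r.
Qed.

End Pair.

Lemma S_irreducible : irreducible S.
Proof.
move=> L [hL iL iLo]; set L' := orthogonal_complement L in iLo *.
have hL' : closed_subspace L' by exact: orthogonal_closed.
have orth x y : L x -> L' y -> inner H x y = 0 by move=> Lx; exact.
have orth' x y : L' x -> L y -> inner H x y = 0.
  by move=> hx hy; apply: inner_sym0; exact: orth.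
have dec z : exists2 x, L x & L' (z - x) by exact: projection.
have dec' z : exists2 x, L' x & L (z - x).
  by have [x Lx h] := dec z; exists (z - x) => //; rewrite subKr.
have [e0|e0] := eA0_dichotomy hL hL' iL iLo orth dec.
  by right; exact: (eA0_full hL hL' iL iLo orth dec).
left; have h := eA0_full hL' hL iLo iL orth' dec' e0.
apply/seteqP; split => [x Lx|_ ->]; last exact: subspace_0.
have : inner H x x = 0 by apply: orth => //; rewrite h.
by move=> /eqP; rewrite dnorm_eq0 => /eqP.
Qed.

End Irreducible.

(** * S has two generators *)

Section PolyOp.
Context {R : realType} {H : hilbertType R} (T : {linear H -> H}).

Lemma poly_op_widen (p : {poly R[i]}) (x : H) n : (size p <= n)%N ->
  poly_op T p x = \sum_(k < n) p`_k *: iter k T x.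
Proof.
move=> pn; rewrite (@sum_ord_widen0 _ (fun k => p`_k *: iter k T x) (size p))//.
by move=> i hi; rewrite nth_default// scale0r.
Qed.

Lemma poly_op_lin a (p q : {poly R[i]}) x :
  poly_op T (a *: p + q) x = a *: poly_op T p x + poly_op T q x.
Proof.
pose n := maxn (size (a *: p + q)) (maxn (size p) (size q)).
rewrite !(@poly_op_widen _ _ n) ?leq_maxl//; last first.
- by rewrite /n leq_max leq_maxl orbT.
- by rewrite /n !leq_max leqnn !orbT.
rewrite scaler_sumr -big_split; apply: eq_bigr => k _.
by rewrite coefD coefZ scalerDl scalerA.
Qed.

Lemma poly_op0 x : poly_op T 0 x = 0.
Proof. by rewrite /poly_op size_poly0 big_ord0. Qed.

Lemma poly_opXn n x : poly_op T 'X^n x = iter n T x.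
Proof.
rewrite (@poly_op_widen _ _ n.+1) ?size_polyXn// big_ord_recr/= big1 => [|i _].
  by rewrite coefXn eqxx scale1r add0r.
by rewrite coefXn ltn_eqF ?scale0r.
Qed.

Lemma P2_subspace n (F : 'I_n -> H) : closed_subspace (P2 T F).
Proof.
apply: closure_subspace; first by exists (fun=> 0); rewrite big1// => i _; rewrite poly_op0.
move=> a x y [p ->] [q ->]; exists (fun i => a *: p i + q i).
rewrite scaler_sumr -big_split; apply: eq_bigr => i _; exact/esym/poly_op_lin.
Qed.

End PolyOp.

(** * Polynomial interpolation at the nodes and the weight v *)

Section Interpolation.
Context {R : realType}.
Context (lam : nat -> R[i]).
Context (lam_half : forall k, nm (lam k - half) < 8^-1).
Context (lam_inj : injective lam).

Lemma lagrange m n : exists p : {poly R[i]}, p.[lam n] = 1 /\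
  forall k, (k <= m)%N -> k != n -> p.[lam k] = 0.
Proof.
pose Q := \prod_(k < m.+1 | (k : nat) != n) ('X - (lam k)%:P).
have Qn : Q.[lam n] != 0.
  rewrite horner_prod; apply/prodf_neq0 => i ni; rewrite hornerXsubC subr_eq0.
  by apply: contra ni => /eqP/lam_inj ->.
exists (Q.[lam n]^-1 *: Q); split; first by rewrite hornerZ mulVf.
move=> k km kn; rewrite hornerZ (_ : Q.[lam k] = 0) ?mulr0//.
rewrite horner_prod (bigD1 (Ordinal (km : (k < m.+1)%N)))//=.
by rewrite hornerXsubC subrr mul0r.
Qed.

Lemma poly_bound (p : {poly R[i]}) : exists2 B : R, 0 <= B &
  forall z, nm z <= 1 -> nm p.[z] <= B.
Proof.
exists (\sum_(i < size p) nm p`_i) => [|z hz].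
  by apply: sumr_ge0 => i _; exact: nm_ge0.
rewrite horner_coef; apply: le_trans (nm_sum _ _ _) _.
apply: ler_sum => i _; rewrite Normc.normcM nmX ler_piMr ?nm_ge0//.
by rewrite exprn_ile1 ?nm_ge0.
Qed.

(* Multiplying a Lagrange polynomial by (z / lam n)^M makes its coefficients
   small on the circle of radius 1/4, since 1/4 < 3/8 <= |lam n|. *)
Lemma interpolation m n (e : R) : 0 < e -> exists p : {poly R[i]},
  [/\ p.[lam n] = 1, forall k, (k <= m)%N -> k != n -> p.[lam k] = 0
    & sqn (fun i => p`_i * quarter ^+ i) <= e].
Proof.
move=> e0; have [L [L1 L0]] := lagrange m n.
have sL : sqs (fun i => L`_i).
  by apply: (@sqs_fin _ _ (size L)) => i hi; rewrite nth_default.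
set K := sqn (fun i => L`_i); have K0 : 0 <= K by exact: sqn_ge0.
(* 4/9 is the square of 2/3 = (1/4) / (3/8). *)
have q0 : (0 : R) <= 4 / 9 by rewrite divr_ge0.
have q1 : (4 / 9 : R) < 1 by lra.
have eK : 0 < e / (K + 1) by rewrite divr_gt0//; lra.
have [M /(_ M (leqnn _)) hM] := expr_small q0 q1 eK.
have ln := lam_neq0 lam_half n.
exists ((lam n)^-1 ^+ M *: ('X^M * L)); split.
- by rewrite hornerZ hornerM hornerXn L1 mulr1 -exprMn mulVf// expr1n.
- by move=> k km kn; rewrite hornerZ hornerM L0// !mulr0.
have qn : nm ((lam n)^-1 * quarter) <= 2 / 3.
  have h := lam_ge lam_half n.
  rewrite Normc.normcM nm_quarter Normc.normcV ler_pdivrMr// invf_ple ?posrE; lra.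
apply: sqn_le => N.
apply: (@le_trans _ _ (\sum_(i < M + N)
    nm (((lam n)^-1 ^+ M *: ('X^M * L))`_i * quarter ^+ i) ^+ 2)).
  apply: (@sum_ord_widen R (fun i => nm (((lam n)^-1 ^+ M *: ('X^M * L))`_i * quarter ^+ i) ^+ 2)).
    exact: leq_addl.
  by move=> i; exact: sqr_ge0.
rewrite big_split_ord /= big1 ?add0r => [|i _]; last first.
  by rewrite coefZ coefXnM ltn_ord mulr0 mul0r Normc.normc0 expr0n.
apply: (@le_trans _ _ (\sum_(i < N) (4 / 9) ^+ M * nm L`_i ^+ 2)).
  apply: ler_sum => i _; rewrite coefZ coefXnM ltnNge leq_addr /= addKn.
  have -> : (lam n)^-1 ^+ M * L`_i * quarter ^+ (M + i) =
      ((lam n)^-1 * quarter) ^+ M * (L`_i * quarter ^+ i) by rewrite exprD exprMn; ring.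
  rewrite Normc.normcM exprMn ler_pM ?sqr_ge0//.
    rewrite nmX -exprM mulnC exprM lerXn2r ?nnegrE ?sqr_ge0 ?divr_ge0//.
    by have := nm_ge0 ((lam n)^-1 * quarter); nra.
  rewrite ler_sqr ?nnegrE ?nm_ge0// Normc.normcM ler_piMr ?nm_ge0//.
  by rewrite nmX exprn_ile1 ?nm_ge0// quarter_le1.
rewrite -mulr_sumr; have h := sqn_ub N sL; rewrite -/K in h.
move: hM; rewrite ltr_pdivlMr; last lra.
have : (0 : R) <= (4 / 9) ^+ M by exact: exprn_ge0.
nra.
Qed.

(** With v as l^2 component and 1 as last component of a generator, p(S) acts by p(lam k) v_k and by
    the coefficients p_i 4^-i: the first condition isolates node n and the second makes the last
    component negligible. *)
Lemma cyclic_weights : exists v : nat -> R[i],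
  [/\ sqs v, forall k, v k != 0 &
    forall n (e : R), 0 < e -> exists p : {poly R[i]},
      sqn (fun k => p.[lam k] * v k - v n * dlt n k) <= e /\
      sqn (fun i => p`_i * quarter ^+ i) <= e].
Proof.
have /choice[f Hf] (t : nat * nat) : exists q : {poly R[i]} * R,
  [/\ q.1.[lam t.2] = 1, forall k, (k <= t.1)%N -> k != t.2 -> q.1.[lam k] = 0,
      sqn (fun i => q.1`_i * quarter ^+ i) <= invS R t.1, 0 <= q.2
    & forall k, nm q.1.[lam k] <= q.2].
  have [p [h1 h2 h3]] := interpolation t.1 t.2 (invS_gt0 R t.1).
  have [B B0 hB] := poly_bound p.
  by exists (p, B); split => //= k; apply: hB; exact: lam_le1.
(* D k dominates at all nodes the interpolation polynomials of order m < k, so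
   that dividing by D k makes their tails square summable, uniformly small. *)
pose D k : R := 1 + \sum_(m < k) \sum_(n < m.+1) (f (m : nat, n : nat)).2.
have D0 k : 1 <= D k.
  rewrite /D lerDl; apply: sumr_ge0 => m _; apply: sumr_ge0 => n _.
  by case: (Hf (m : nat, n : nat)).
have DB k m n : (m < k)%N -> (n <= m)%N -> (f (m, n)).2 <= D k.
  move=> mk nm'; rewrite /D (bigD1 (Ordinal mk))//=.
  rewrite (bigD1 (Ordinal (nm' : (n < m.+1)%N)))//=.
  have s1 : 0 <= \sum_(i < m.+1 | i != Ordinal (nm' : (n < m.+1)%N)) (f (m, i : nat)).2.
    by apply: sumr_ge0 => j _; case: (Hf (m, j : nat)).
  have s2 : 0 <= \sum_(i < k | i != Ordinal mk) \sum_(j < i.+1) (f (i : nat, j : nat)).2.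
    by apply: sumr_ge0 => i _; apply: sumr_ge0 => j _; case: (Hf (i : nat, j : nat)).
  lra.
pose v k : R[i] := half ^+ k * ((D k)^-1)%:C.
have nD k : nm ((D k)^-1%:C : R[i]) = (D k)^-1.
  by rewrite nm_real ger0_norm// invr_ge0; have := D0 k; lra.
have sh : sqs (fun k => half ^+ k : R[i]).
  exists 2 => N; apply: le_trans (_ : \sum_(i < N) (4^-1 : R) ^+ i <= _).
    apply: ler_sum => i _; rewrite nmX nm_half -exprM mulnC exprM lerXn2r ?nnegrE ?sqr_ge0 ?invr_ge0//.
    by lra.
  by apply: geom_le2; lra.
exists v; split.
- apply: (sqs_le (c := 1) sh) => k; rewrite mul1r Normc.normcM nD.
  by rewrite ler_piMr ?nm_ge0// invf_le1 ?(lt_le_trans ltr01).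
- move=> k; rewrite mulf_neq0 ?expf_neq0//.
    by apply: contraTneq (_ : 0 < nm (half : R[i])) => [->|];
      rewrite ?Normc.normc0 ?ltxx// nm_half invr_gt0.
  rewrite fmorph_eq0 invr_eq0; have := D0 k; apply: contraTneq => ->.
  by rewrite ler10.
move=> n e e0.
have [N HN] := sqn_tail sh e0; have [N' hN'] := invS_small e0.
(* m >= n puts node n among the interpolated ones, m >= N makes the tail of 2^-k beyond m small, and
   m >= N' does the same for the last component. *)
pose m := maxn n (maxn N N').
have nm' : (n <= m)%N by exact: leq_maxl.
have Nm : (N <= m)%N by rewrite /m !leq_max leqnn orbT.
have N'm : (N' <= m)%N by rewrite /m !leq_max leqnn !orbT.
have [/= h1 h2 h3 h4 h5] := Hf (m, n); set p := (f (m, n)).1 in h1 h2 h3 h5.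
exists p; split; last first.
  by apply: le_trans h3 _; apply: le_trans (ltW hN'); exact: invS_le.
have tl : sqs (fun i => if (i < m.+1)%N then 0 else half ^+ i : R[i]).
  by apply: (sqs_le (c := 1) sh) => i; rewrite mul1r; case: ifP; rewrite ?Normc.normc0 ?nm_ge0.
have Nm1 := HN m.+1 (leqW Nm).
apply: le_trans Nm1; apply: sqn_le => M; apply: le_trans (sqn_ub M tl).
apply: ler_sum => k _; have [km|mk] := ltnP k m.+1.
  rewrite /dlt; case: eqP => [->|/eqP kn].
    by rewrite h1 mul1r mulr1 subrr Normc.normc0 expr0n.
  by rewrite h2// mul0r mulr0 subrr Normc.normc0 expr0n.
have kn : (k : nat) == n = false by rewrite gtn_eqF// (leq_ltn_trans nm' mk).
rewrite /dlt kn mulr0 subr0 ler_sqr ?nnegrE ?nm_ge0//.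
rewrite /v mulrCA Normc.normcM ler_piMr ?nm_ge0// Normc.normcM nD.
have Dk := D0 k; have := DB k m n mk nm'; have := h5 k => a1 a2.
by rewrite ler_pdivrMr; lra.
Qed.

End Interpolation.

(** * Density of the span of two orbits *)

Section TwoCyclic.
Context {R : realType}.
Context (lam : nat -> R[i]).
Context (lam_half : forall k, nm (lam k - half) < 8^-1).
Context (lam_inj : injective lam).
Notation H := (l2_hilbert (A := Hdom lam_half)).
Notation S := (modelS lam_half).

(** Since y is orthogonal to every (f, 0, 0) with f in H^2, the a-component of x can be subtracted.
    The principal part left has squared norm at most 2 * 8 e^2 + 2 e^2 <= (5 e)^2, and there are
    five components, whence 25. *)
Lemma inner_bound (x y : H) (e : R) : 0 <= e -> (forall n, y iA n = 0) ->
  sqn (x iU) <= e ^+ 2 -> sqn (x iC) <= e ^+ 2 -> nm (inner H x y) <= 25 * e * nrm y.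
Proof.
move=> e0 yA hU hC.
pose a : H := mkH lam_half (l2_sqs x iA) (@sqs0 R) (@sqs0 R).
have ay : inner H a y = 0.
  rewrite innerE (_ : y iA = fun=> 0) ?sdot0r; last exact/funext.
  rewrite (_ : a iB = fun=> 0); last first.
    by apply/funext => i; rewrite /= /mk5 /= coup0 at00 addr0.
  by rewrite /= /mk5 /= !sdot0l !addr0.
have -> : inner H x y = inner H (x - a) y by rewrite innerBl ay subr0.
apply: le_trans (inner_CS _ _) _; rewrite ler_wpM2r ?nrm_ge0//.
have -> : 25 * e = #|'I_5|%:R * (5 * e) by rewrite card_ord; ring.
have e5 : e ^+ 2 <= (5 * e) ^+ 2 by rewrite exprMn; have := sqr_ge0 e; lra.
have uk k : nm (x iU k) <= e.
  by rewrite -ler_sqr ?nnegrE ?nm_ge0//; exact: le_trans (nm_coord_sqn k (l2_sqs x iU)) hU.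
have c0 : nm (x iC 0%N) ^+ 2 <= e ^+ 2.
  exact: le_trans (nm_coord_sqn 0%N (l2_sqs x iC)) hC.
apply: nrm_le; first by rewrite mulr_ge0.
have E c (z : nat -> R[i]) : (forall i, (x - a) c i = z i) -> sqn ((x - a) c) = sqn z.
  by move=> /funext ->.
apply: ord5_cases.
- rewrite (E iA (fun=> 0)) ?sqn0 ?sqr_ge0// => i.
  by rewrite l2E_add l2E_opp /= /mk5 /= subrr.
- rewrite (E iB (x iB)) => [|i]; last first.
    by rewrite l2E_add l2E_opp /= /mk5 /= coup0 at00 addr0 subr0.
  apply: sqn_le => N.
  apply: (@le_trans _ _ (\sum_(n < N) (2 * nm (coup lam (x iU) n) ^+ 2 +
      2 * nm (at0 (x iC 0%N) n) ^+ 2))).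
    by apply: ler_sum => n _; rewrite coordB; exact: nmD2.
  rewrite big_split/= -!mulr_sumr.
  have h1 := coup_psum lam_half N uk.
  have h2 : \sum_(n < N) nm (at0 (x iC 0%N) n) ^+ 2 <= e ^+ 2.
    case: N {h1} => [|N]; first by rewrite big_ord0 sqr_ge0.
    by rewrite big_ord_recl big1 ?addr0// => i _; rewrite [at0 _ _]/= Normc.normc0 expr0n.
  rewrite exprMn; lra.
- rewrite (E iU (x iU)); first exact: le_trans hU e5.
  by move=> i; rewrite l2E_add l2E_opp /= /mk5 /= subr0.
- rewrite (E iC (x iC)); first exact: le_trans hC e5.
  by move=> i; rewrite l2E_add l2E_opp /= /mk5 /= subr0.
- rewrite (E iD (fun=> 0)) ?sqn0 ?sqr_ge0// => i.
  by rewrite l2E_add l2E_opp coordD /= /mk5 /= subr0.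
Qed.

Lemma inner_small0 (z : R[i]) (y : H) :
  (forall e : R, 0 < e -> nm z <= 25 * e * nrm y) -> z = 0.
Proof.
move=> h; apply: small_eq0 => e e0.
have K0 : 0 < 25 * (nrm y + 1) by have := nrm_ge0 y; lra.
have t0 := divr_gt0 e0 K0; apply: le_trans (h _ t0) _.
have tK : e / (25 * (nrm y + 1)) * (25 * (nrm y + 1)) = e by rewrite divfK// gt_eqF.
by move: (e / _) t0 tK => t t0 tK; lra.
Qed.

(** Modulo H^2, which y annihilates, x is a limit of finite combinations of the [vU k]. *)
Lemma inner_C0 (x y : H) : (forall n, y iA n = 0) ->
  (forall k, inner H (vU lam_half k) y = 0) -> (forall i, x iC i = 0) -> inner H x y = 0.
Proof.
move=> yA yU xC; apply: (@inner_small0 _ y) => e e0.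
have [N /(_ N (leqnn _)) hN] := sqn_tail (l2_sqs x iU) (exprn_gt0 2 e0).
pose s : H := \sum_(k < N) x iU k *: vU lam_half k.
have sy : inner H s y = 0.
  rewrite /s; elim/big_rec: _ => [|k z _ hz]; first exact: inner0l.
  by rewrite innerDl innerZl yU mulr0 add0r.
have sU i : s iU i = if (i < N)%N then x iU i else 0.
  rewrite l2E_sum; case: ifPn => [iN|].
    rewrite (bigD1 (Ordinal iN))// big1 => [|j ji].
      by rewrite l2E_scale /= /mk5 /= /dlt eqxx mulr1 addr0.
    rewrite l2E_scale /= /mk5 /= /dlt; case: eqP => [h|_]; last by rewrite mulr0.
    by case/eqP: ji; apply: val_inj.
  rewrite -leqNgt => Ni; rewrite big1// => j _.
  by rewrite l2E_scale /= /mk5 /= /dlt gtn_eqF ?mulr0// (leq_trans (ltn_ord j)).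
have sC i : s iC i = 0.
  by rewrite l2E_sum big1// => j _; rewrite l2E_scale /= /mk5 /= mulr0.
have -> : inner H x y = inner H (x - s) y by rewrite innerBl sy subr0.
apply: inner_bound => //; first exact: ltW.
  rewrite (_ : (x - s) iU = fun i => if (i < N)%N then 0 else x iU i)//.
  apply/funext => i; rewrite l2E_add l2E_opp sU; case: ifP => _.
    by rewrite subrr.
  by rewrite subr0.
rewrite (_ : (x - s) iC = fun=> 0) ?sqn0 ?sqr_ge0//.
by apply/funext => i; rewrite l2E_add l2E_opp sC xC subrr.
Qed.

Lemma iterU n (x : H) k : iter n S x iU k = lam k ^+ n * x iU k.
Proof.
elim: n => [|n IH]; first by rewrite expr0 mul1r.
by rewrite iterS SE /shift5 /= /mk5 /= IH exprS mulrA.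
Qed.

Lemma iterC n (x : H) i : x iC = dlt 0 -> iter n S x iC i = quarter ^+ n * dlt n i.
Proof.
move=> xC; elim: n i => [|n IH] i; first by rewrite xC expr0 mul1r.
rewrite iterS SE /shift5 /= /mk5 /= coordD; case: i => [|i] /=.
  by rewrite /dlt /= !mulr0.
by rewrite IH exprS mulrA /dlt eqSS.
Qed.

Lemma poly_opU p (x : H) k : poly_op S p x iU k = p.[lam k] * x iU k.
Proof.
rewrite /poly_op l2E_sum horner_coef mulr_suml; apply: eq_bigr => j _.
by rewrite l2E_scale iterU mulrA.
Qed.

Lemma poly_opC p (x : H) i : x iC = dlt 0 -> poly_op S p x iC i = p`_i * quarter ^+ i.
Proof.
move=> xC; rewrite (@poly_op_widen _ H S _ _ (maxn (size p) i.+1)) ?leq_maxl//.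
have im : (i < maxn (size p) i.+1)%N by exact: leq_maxr.
rewrite l2E_sum (bigD1 (Ordinal im))// big1 => [|j ji].
  by rewrite [LHS]addr0 l2E_scale iterC// /dlt eqxx mulr1.
rewrite l2E_scale iterC// /dlt; case: eqP => [h|_]; last by rewrite !mulr0.
by case/eqP: ji; apply: val_inj.
Qed.

Lemma two_generators : exists F : 'I_2 -> H, P2 S F = setT.
Proof.
have [v [sv v0 Hv]] := cyclic_weights lam_half lam_inj.
pose g : H := mkH lam_half (@sqs0 R) sv (sqs_dlt 0).
pose F (i : 'I_2) : H := if i == ord0 then eA lam_half 0 else g.
exists F; apply: subspace_full; first exact: P2_subspace.
move=> y hy.
have hp p q : inner H (poly_op S p (eA lam_half 0) + poly_op S q g) y = 0.
  apply: hy; apply: subset_closure; exists (fun i => if i == ord0 then p else q).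
  by rewrite big_ord_recl big_ord1 /F.
have yA n : y iA n = 0.
  rewrite -(inner_eA y); apply: inner_sym0.
  by have := hp 'X^n 0; rewrite poly_op0 addr0 poly_opXn iter_eA.
have hq q : inner H (poly_op S q g) y = 0.
  by have := hp 0 q; rewrite poly_op0 add0r.
(* A polynomial concentrated at node n brings p(S) g close to v n times [vU n] in the u and c
   components, the only ones that matter by [yA]. *)
have yU n : inner H (vU lam_half n) y = 0.
  apply: (mulfI (v0 n)); rewrite mulr0; apply: (@inner_small0 _ y) => e e0.
  have [p [h1 h2]] := Hv n (e ^+ 2) (exprn_gt0 2 e0).
  have -> : v n * inner H (vU lam_half n) y =
      - inner H (poly_op S p g - v n *: vU lam_half n) y.
    by rewrite innerBl hq innerZl sub0r opprK.
  rewrite nmN; apply: inner_bound => //; first exact: ltW.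
    apply: le_trans h1; rewrite le_eqVlt; apply/orP; left; apply/eqP.
    by congr sqn; apply/funext => k; rewrite l2E_add l2E_opp l2E_scale poly_opU.
  apply: le_trans h2; rewrite le_eqVlt; apply/orP; left; apply/eqP.
  congr sqn; apply/funext => k; rewrite l2E_add l2E_opp l2E_scale poly_opC//.
  by rewrite /= /mk5 /= mulr0 subr0.
(* S^n g and 4^-n [wC n] have the same last component, so [inner_C0] applies to their difference. *)
have yC n : inner H (wC lam_half n) y = 0.
  have q0 : quarter ^+ n != 0 :> R[i].
    apply: expf_neq0; apply: contraTneq (_ : 0 < nm (quarter : R[i])) => [->|];
      by rewrite ?Normc.normc0 ?ltxx// nm_quarter invr_gt0.
  apply: (mulfI q0); rewrite mulr0 -innerZl.
  have := hq 'X^n; rewrite poly_opXn => h.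
  have := @inner_C0 (iter n S g - quarter ^+ n *: wC lam_half n) y yA yU.
  rewrite innerBl h sub0r => h'; apply/eqP; rewrite -oppr_eq0 h'// => i.
  by rewrite l2E_add l2E_opp l2E_scale iterC// subrr.
have yC1 n : y iC n.+1 = 0.
  have := inner_sym0 (yC n.+1); rewrite innerE /= /mk5 /= !sdot0r sdot_dltr add0r addr0.
  rewrite (_ : (fun n0 : nat => _) = fun=> 0) ?sdot0r ?add0r//.
  by apply/funext => i; rewrite coup0 at00 addr0.
(* The product with [wC 0] also involves the pole 1/z and does not read off the coordinate c_0 of y;
   c_0 is removed by subtraction instead. *)
have : inner H (y - y iC 0%N *: wC lam_half 0) y = 0.
  apply: inner_C0 => // i.
  rewrite l2E_add l2E_opp l2E_scale; case: i => [|i]; rewrite /= /mk5 /= /dlt /=.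
    by rewrite mulr1 subrr.
  by rewrite yC1 mulr0 subr0.
rewrite innerBl innerZl yC mulr0 subr0.
by move=> /eqP; rewrite dnorm_eq0 => /eqP.
Qed.

End TwoCyclic.

Theorem corollary1 (R : realType) :
  exists (H : hilbertType R) (S : {linear H -> H}),
    [/\ bounded_op S, subnormal S, irreducible S, cyclic_op 2 S
      & closure (spectrum S `\` essential_spectrum S)
        <> closure (interior (spectrum S))].
Proof.
have [lam [lam_inj lam_half lam_dense]] := @dense_nodes R.
exists (l2_hilbert (A := Hdom lam_half)), (modelS lam_half); split.
- exact: S_bounded.
- exact: S_subnormal.
- exact: S_irreducible lam_inj.
- split; [exact: two_generators lam_inj | exact: not_1_cyclic].
- exact: spectral_inequality lam_dense.
Qed.
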